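(* Let $A=\begin{bmatrix}a_{11}&\bar a_{21}\\ a_{21}&a_{22}\end{bmatrix}$ be a Hermitian matrix of order two (real symmetric, $\mathbb{F}=\mathbb{R}$, or complex Hermitian, $\mathbb{F}=\mathbb{C}$) whose entries have floating-point components, and assume the standard (IEEE 754) non-stop floating-point arithmetic in at least single precision ($p\ge 23$) with rounding to nearest, tie to even. If $$\hat a=\max_{1\le j\le i\le 2}|a_{ij}|\le\frac{\nu}{4\sqrt2},$$ then none of the computed quantities $\mathrm{fl}(|a_{21}|)$, $\mathrm{fl}(\cos\alpha)$, $\mathrm{fl}(\sin\alpha)$, $\mathrm{fl}(\tan 2\varphi)$, $\mathrm{fl}(\tan\varphi)$, $\mathrm{fl}(\sec^2\varphi)$, $\mathrm{fl}(\sec\varphi)$, $\mathrm{fl}(\cos\varphi)$, $\mathrm{fl}(\sin\varphi)$, $\mathrm{fl}(\lambda_1)$, $\mathrm{fl}(\lambda_2)$, defined in the context, overflows; in particular, the computed eigenvalues do not overflow. Moreover, barring any underflow of the results of those computations, there are real factors $\delta_\alpha',\delta_\alpha'',\delta_\varphi^{\mathbb{F}},\delta_c^{\mathbb{F}}$ such that $\mathrm{fl}(\cos\alpha)=\delta_\alpha'\cos\alpha$, $\mathrm{fl}(\sin\alpha)=\delta_\alpha''\sin\alpha$, $\mathrm{fl}(\tan\varphi)=\delta_\varphi^{\mathbb{F}}\tan\varphi$, $\mathrm{fl}(\cos\varphi)=\delta_c^{\mathbb{F}}\cos\varphi$, and each of $\delta_\alpha'$, $\delta_\alpha''$, $|\mathrm{fl}(\mathrm{e}^{\pm\mathrm{i}\alpha})|$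 lies strictly between $1-4.000000\,\varepsilon$ and $1+4.000001\,\varepsilon$, while $$1-5.500000\,\varepsilon<\delta_\varphi^{\mathbb{R}}<1+5.500001\,\varepsilon,\qquad 1-11.500000\,\varepsilon<\delta_\varphi^{\mathbb{C}}<1+11.500004\,\varepsilon,$$ $$1-8.000000\,\varepsilon<\delta_c^{\mathbb{R}}<1+8.000002\,\varepsilon,\qquad 1-14.000000\,\varepsilon<\delta_c^{\mathbb{C}}<1+14.000006\,\varepsilon.$$
   Context: **Floating-point conventions.** Floating-point numbers are those of a standard IEEE 754 binary format (with subnormal numbers) with $p$ explicitly stored significand bits ($p=23,52,112$ for single, double, quadruple precision). $\mathrm{fl}$ of a single operation is its correctly rounded result, and $\mathrm{fl}$ of a named quantity below denotes its computed value. $\nu$ is the largest finite and $\check\mu$ the smallest positive (subnormal) floating-point number; $\varepsilon=2^{-(p+1)}$. $\mathrm{fma}(a,b,c)=\mathrm{fl}(a\cdot b+c)$ is the fused multiply-add with a single rounding. $\mathrm{fmin}$ and $\mathrm{fmax}$ return their second argument if the first one is NaN. $\mathrm{sign}(\pm0)=\pm1$. Underflow means that a nonzero result is smaller in magnitude than the smallest positive normal number. ''Non-stop'' means that exceptional operations do not trap: e.g., $0/0$ yields NaN and $x/0$ yields $\infty$ for $x>0$. **Exact quantities.** $\alpha=\arg a_{21}$ with $\arg 0=0$, where $a_{21}=0$ is understood to be represented with the real part $+0$; in the real case $\mathrm{e}^{\mathrm{i}\alpha}=\mathrm{sign}\,a_{21}=\pm1$. With $a=a_{11}-a_{22}$,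 $\varphi\in[-\pi/4,\pi/4]$ is the angle with $\tan2\varphi=\frac{2|a_{21}|}{|a|}\,\mathrm{sign}\,a$ if $a\ne0$; if $a=0$ and $a_{21}\neq0$, then $\varphi=\pi/4$; if $a=a_{21}=0$, then $\varphi=0$. **Computed quantities.** In the real case $\mathrm{fl}(|a_{21}|)=|a_{21}|$ and $\mathrm{fl}(\cos\alpha)=\mathrm{sign}\,a_{21}$, $\mathrm{fl}(\sin\alpha)=0$. In the complex case, with $m=\min\{|\Re a_{21}|,|\Im a_{21}|\}$, $M=\max\{|\Re a_{21}|,|\Im a_{21}|\}$, $\tilde q=\mathrm{fmax}(\mathrm{fl}(m/M),0)$, $$\mathrm{fl}(|a_{21}|)=\mathrm{fl}\bigl(M\cdot\mathrm{fl}\bigl(\sqrt{\mathrm{fma}(\tilde q,\tilde q,1)}\bigr)\bigr),$$ $$\mathrm{fl}(\cos\alpha)=\mathrm{fmin}\bigl(\mathrm{fl}(|\Re a_{21}|/\mathrm{fl}(|a_{21}|)),1\bigr)\cdot\mathrm{sign}\,\Re a_{21},\qquad \mathrm{fl}(\sin\alpha)=\mathrm{fl}\bigl(\Im a_{21}/\max\{\mathrm{fl}(|a_{21}|),\check\mu\}\bigr).$$ $\mathrm{fl}(\mathrm{e}^{\pm\mathrm{i}\alpha})=\mathrm{fl}(\cos\alpha)\pm\mathrm{i}\,\mathrm{fl}(\sin\alpha)$. Let $\tilde o=2\,\mathrm{fl}(|a_{21}|)$ and $\tilde a=\mathrm{fl}(a_{11}-a_{22})$. Then $$\mathrm{fl}(\tan2\varphi)=\min\bigl(\mathrm{fmax}(\mathrm{fl}(\tilde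 o/|\tilde a|),0),\mathrm{fl}(\sqrt\nu)\bigr)\cdot\mathrm{sign}\,\tilde a$$ (the quotient $\mathrm{fl}(\tilde o/|\tilde a|)$ here is only an intermediate value, which may be infinite or NaN). With $\tau=\mathrm{fl}(\tan 2\varphi)$, $$\mathrm{fl}(\tan\varphi)=\mathrm{fl}\Bigl(\tau\big/\mathrm{fl}\bigl(1+\mathrm{fl}(\sqrt{\mathrm{fma}(\tau,\tau,1)})\bigr)\Bigr).$$ With $\tilde t=\mathrm{fl}(\tan\varphi)$: $\mathrm{fl}(\sec^2\varphi)=\mathrm{fma}(\tilde t,\tilde t,1)$, $\mathrm{fl}(\sec\varphi)=\mathrm{fl}(\sqrt{\mathrm{fl}(\sec^2\varphi)})$, $\mathrm{fl}(\cos\varphi)=\mathrm{fl}(1/\mathrm{fl}(\sec\varphi))$, $\mathrm{fl}(\sin\varphi)=\mathrm{fl}(\tilde t/\mathrm{fl}(\sec\varphi))$. The eigenvalues are computed as $$\mathrm{fl}(\lambda_1)=\mathrm{fl}\bigl(\mathrm{fma}(\mathrm{fma}(a_{22},\tilde t,\tilde o),\tilde t,a_{11})/\mathrm{fl}(\sec^2\varphi)\bigr),\qquad \mathrm{fl}(\lambda_2)=\mathrm{fl}\bigl(\mathrm{fma}(\mathrm{fma}(a_{11},\tilde t,-\tilde o),\tilde t,a_{22})/\mathrm{fl}(\sec^2\varphi)\bigr).$$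
   Formalization: The equation fl(tan φ)=δ_φ tan φ is claimed only if, when a=0 and a21≠0, fl(a11−a22) is +0; this excludes just a11=−0, a22=+0, where fl(tan φ)≈−1 although φ=π/4. *)

(* Defs.v *)
From Stdlib Require Import Reals ZArith List SpecFloat.
From Coquelicot Require Import Coquelicot.
Import ListNotations.
Open Scope R_scope.

(** * Formats *)

(** A binary format is given by its number [sig_bits] of explicitly stored
    significand bits (so the precision is one more) and the width [exp_bits] of
    its exponent field.  [prec] and [emax] are the parameters of [SpecFloat];
    all [SF*] operations round to nearest, ties to even, without trapping. *)
Record format := Format { sig_bits : Z; exp_bits : Z }.

Definition prec (F : format) : Z := (sig_bits F + 1)%Z.
Definition emax (F : format) : Z := (2 ^ (exp_bits F - 1))%Z.

(** The binary interchange formats of IEEE 754: binary16, binary32, binary64,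
    binary128, and binary{k} for k >= 128 a multiple of 32, whose exponent width
    is w = round(4 log2 k) - 13, i.e. |w + 13 - 4 log2 k| <= 1/2, and whose
    remaining bits are the sign bit and the k - w - 1 significand bits. *)
Definition ieee_binary (F : format) : Prop :=
  In (sig_bits F, exp_bits F) [(10, 5); (23, 8); (52, 11); (112, 15)]%Z \/
  exists k : Z,
    (128 <= k)%Z /\ (k mod 32 = 0)%Z /\
    sig_bits F = (k - exp_bits F - 1)%Z /\
    (2 ^ (2 * exp_bits F + 25) <= k ^ 8 <= 2 ^ (2 * exp_bits F + 27))%Z.

(** * Floating-point numbers and operations *)

(** Real value; infinities and NaN get the junk value 0. *)
Definition SF2R (x : spec_float) : R :=
  match x with
  | S754_finite s m e => IZR (cond_Zopp s (Zpos m)) * powerRZ 2 e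
  | _ => 0
  end.

Definition finite_SF (x : spec_float) : Prop :=
  match x with
  | S754_zero _ | S754_finite _ _ _ => True
  | S754_infinity _ | S754_nan => False
  end.

Definition fp_number (F : format) (x : spec_float) : Prop :=
  finite_SF x /\ valid_binary (prec F) (emax F) x = true.

Definition signbit (x : spec_float) : bool :=
  match x with
  | S754_zero s | S754_infinity s | S754_finite s _ _ => s
  | S754_nan => false
  end.

(** [x * sign y] with [sign (+0) = 1] and [sign (-0) = -1]; this is exact. *)
Definition mul_sign (x y : spec_float) : spec_float :=
  if signbit y then SFopp x else x.

Definition fzero : spec_float := S754_zero false.

Section Operations.
Context (F : format).

Definition fone : spec_float := SFone (prec F) (emax F).
Definition nu : spec_float := SFmax_float (prec F) (emax F).
Definition mu_check : spec_float := S754_finite false 1 (emin (prec F) (emax F)).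
Definition min_normal : R := powerRZ 2 (2 - emax F).
Definition eps : R := powerRZ 2 (- (sig_bits F + 1)).

Definition fadd : spec_float -> spec_float -> spec_float := SFadd (prec F) (emax F).
Definition fsub : spec_float -> spec_float -> spec_float := SFsub (prec F) (emax F).
Definition fmul : spec_float -> spec_float -> spec_float := SFmul (prec F) (emax F).
Definition fdiv : spec_float -> spec_float -> spec_float := SFdiv (prec F) (emax F).
Definition fsqrt : spec_float -> spec_float := SFsqrt (prec F) (emax F).

(** Fused multiply-add [x * y + z].  For finite nonzero [x] and [y] the exact
    product has the integer significand [mx * my]; it is aligned with [z] and the
    exact sum is rounded once.  In all other cases the product is itself exact,
    so that [fadd (fmul x y) z] rounds at most once. *)
Definition fma (x y z : spec_float) : spec_float :=
  match x, y, z with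
  | S754_finite sx mx ex, S754_finite sy my ey, S754_finite sz mz ez =>
      let e := Z.min (ex + ey) ez in
      let mxy := cond_Zopp (xorb sx sy) (Zpos (fst (shl_align (mx * my) (ex + ey) e))) in
      let mz' := cond_Zopp sz (Zpos (fst (shl_align mz ez e))) in
      binary_normalize (prec F) (emax F) (mxy + mz') e false
  | S754_finite _ _ _, S754_finite _ _ _, S754_zero _ => fmul x y
  | S754_finite _ _ _, S754_finite _ _ _, _ => z
  | _, _, _ => fadd (fmul x y) z
  end.
End Operations.

(** Both return [y] when [x] is NaN, every comparison with NaN being false. *)
Definition fmin (x y : spec_float) : spec_float := if SFltb x y then x else y.
Definition fmax (x y : spec_float) : spec_float := if SFltb y x then x else y.

(** * Input *)

Inductive scalar :=
  | RealScalar (x : spec_float)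
  | ComplexScalar (re im : spec_float).

(** Hermitian matrix of order two: the diagonal is real and the (1,2) entry is
    the conjugate of [a21].  The constructor of [a21] tells the real from the
    complex case. *)
Record hermitian2 := Hermitian2
  { a11 : spec_float; a22 : spec_float; a21 : scalar }.

Definition scalar_fp (F : format) (z : scalar) : Prop :=
  match z with
  | RealScalar x => fp_number F x
  | ComplexScalar re im => fp_number F re /\ fp_number F im
  end.

Definition hermitian2_fp (F : format) (A : hermitian2) : Prop :=
  fp_number F (a11 A) /\ fp_number F (a22 A) /\ scalar_fp F (a21 A).

Definition scalar_C (z : scalar) : C :=
  match z with
  | RealScalar x => (SF2R x, 0)
  | ComplexScalar re im => (SF2R re, SF2R im)
  end.

Definition real_part (z : scalar) : spec_float :=
  match z with
  | RealScalar x => x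
  | ComplexScalar re _ => re
  end.

(** * Exact quantities *)

Definition abs_max (A : hermitian2) : R :=
  Rmax (Rabs (SF2R (a11 A)))
    (Rmax (Cmod (scalar_C (a21 A))) (Rabs (SF2R (a22 A)))).

Definition is_arg (z : C) (alpha : R) : Prop :=
  - PI < alpha <= PI /\
  z = (Cmod z * cos alpha, Cmod z * sin alpha) /\
  (z = RtoC 0 -> alpha = 0).

(** [tan] is total, with [tan (PI / 2) = 0]; hence the condition on [cos]. *)
Definition is_phi (A : hermitian2) (phi : R) : Prop :=
  let a := SF2R (a11 A) - SF2R (a22 A) in
  let b := Cmod (scalar_C (a21 A)) in
  - PI / 4 <= phi <= PI / 4 /\
  (a <> 0 -> cos (2 * phi) <> 0 /\ tan (2 * phi) = 2 * b / Rabs a * sign a) /\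
  (a = 0 -> b <> 0 -> phi = PI / 4) /\
  (a = 0 -> b = 0 -> phi = 0).

(** * Computed quantities *)

Section Computed.
Context (F : format).

Definition part_min (re im : spec_float) : spec_float := fmin (SFabs re) (SFabs im).
Definition part_max (re im : spec_float) : spec_float := fmax (SFabs re) (SFabs im).
Definition fl_q (re im : spec_float) : spec_float :=
  fmax (fdiv F (part_min re im) (part_max re im)) fzero.
Definition fl_sqrt_1q2 (re im : spec_float) : spec_float :=
  fsqrt F (fma F (fl_q re im) (fl_q re im) (fone F)).

Definition fl_abs (z : scalar) : spec_float :=
  match z with
  | RealScalar x => SFabs x
  | ComplexScalar re im => fmul F (part_max re im) (fl_sqrt_1q2 re im)
  end.

Definition fl_cos_arg (z : scalar) : spec_float :=
  match z with
  | RealScalar x => mul_sign (fone F) x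
  | ComplexScalar re im =>
      mul_sign (fmin (fdiv F (SFabs re) (fl_abs z)) (fone F)) re
  end.

Definition fl_sin_arg (z : scalar) : spec_float :=
  match z with
  | RealScalar _ => fzero
  | ComplexScalar re im => fdiv F im (fmax (fl_abs z) (mu_check F))
  end.

Context (A : hermitian2).

Definition fl_abs_a21 : spec_float := fl_abs (a21 A).
Definition fl_cos_alpha : spec_float := fl_cos_arg (a21 A).
Definition fl_sin_alpha : spec_float := fl_sin_arg (a21 A).

Definition fl_exp_i_alpha : C := (SF2R fl_cos_alpha, SF2R fl_sin_alpha).
Definition fl_exp_mi_alpha : C := (SF2R fl_cos_alpha, - SF2R fl_sin_alpha).

Definition fl_o : spec_float := fmul F (fadd F (fone F) (fone F)) fl_abs_a21.
Definition fl_a : spec_float := fsub F (a11 A) (a22 A).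

Definition fl_tan_2phi : spec_float :=
  mul_sign
    (fmin (fmax (fdiv F fl_o (SFabs fl_a)) fzero) (fsqrt F (nu F)))
    fl_a.

Definition fl_tan_phi_den : spec_float :=
  fadd F (fone F) (fsqrt F (fma F fl_tan_2phi fl_tan_2phi (fone F))).
Definition fl_tan_phi : spec_float := fdiv F fl_tan_2phi fl_tan_phi_den.

Definition fl_sec2_phi : spec_float := fma F fl_tan_phi fl_tan_phi (fone F).
Definition fl_sec_phi : spec_float := fsqrt F fl_sec2_phi.
Definition fl_cos_phi : spec_float := fdiv F (fone F) fl_sec_phi.
Definition fl_sin_phi : spec_float := fdiv F fl_tan_phi fl_sec_phi.

Definition fl_lambda1_num : spec_float :=
  fma F (fma F (a22 A) fl_tan_phi fl_o) fl_tan_phi (a11 A).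
Definition fl_lambda2_num : spec_float :=
  fma F (fma F (a11 A) fl_tan_phi (SFopp fl_o)) fl_tan_phi (a22 A).
Definition fl_lambda1 : spec_float := fdiv F fl_lambda1_num fl_sec2_phi.
Definition fl_lambda2 : spec_float := fdiv F fl_lambda2_num fl_sec2_phi.

(** * Exceptions *)

(** Under rounding to nearest, a computation overflows by delivering an infinity;
    a NaN could only come from such an infinity. *)
Definition no_overflow : Prop :=
  finite_SF fl_abs_a21 /\ finite_SF fl_cos_alpha /\ finite_SF fl_sin_alpha /\
  finite_SF fl_tan_2phi /\ finite_SF fl_tan_phi /\
  finite_SF fl_sec2_phi /\ finite_SF fl_sec_phi /\
  finite_SF fl_cos_phi /\ finite_SF fl_sin_phi /\
  finite_SF fl_lambda1 /\ finite_SF fl_lambda2.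

(** [y] is the computed value of an operation with the exact result [x].  Testing
    [x] and not [y] against zero also counts a result that is flushed to zero. *)
Definition underflows (x : R) (y : spec_float) : Prop :=
  x <> 0 /\ Rabs (SF2R y) < min_normal F.

(** Each computed quantity is paired with the exact result, up to sign, of the
    operation that rounds to it; nothing is rounded in the real case of the first
    three.  The exact results are quotients of reals, so that a division by zero
    gives 0 here: it does not count as an underflow. *)
Definition no_underflow : Prop :=
  match a21 A with
  | RealScalar _ => True
  | ComplexScalar re im =>
      ~ underflows (SF2R (part_max re im) * SF2R (fl_sqrt_1q2 re im)) fl_abs_a21 /\
      ~ underflows (SF2R re / SF2R fl_abs_a21) fl_cos_alpha /\
      ~ underflows (SF2R im / SF2R (fmax fl_abs_a21 (mu_check F))) fl_sin_alpha
  end /\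
  ~ underflows (SF2R fl_o / SF2R fl_a) fl_tan_2phi /\
  ~ underflows (SF2R fl_tan_2phi / SF2R fl_tan_phi_den) fl_tan_phi /\
  ~ underflows (SF2R fl_tan_phi * SF2R fl_tan_phi + 1) fl_sec2_phi /\
  ~ underflows (sqrt (SF2R fl_sec2_phi)) fl_sec_phi /\
  ~ underflows (1 / SF2R fl_sec_phi) fl_cos_phi /\
  ~ underflows (SF2R fl_tan_phi / SF2R fl_sec_phi) fl_sin_phi /\
  ~ underflows (SF2R fl_lambda1_num / SF2R fl_sec2_phi) fl_lambda1 /\
  ~ underflows (SF2R fl_lambda2_num / SF2R fl_sec2_phi) fl_lambda2.

(** * Representation of zero *)

Definition zero_a21_positive : Prop :=
  scalar_C (a21 A) = RtoC 0 -> signbit (real_part (a21 A)) = false.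

(** When [a = 0] and [a21 <> 0] the exact [phi] is [PI / 4], but [fl_a] is -0 for
    [a11 = -0] and [a22 = +0], which makes the computed tangent equal to -1. *)
Definition zero_a_positive : Prop :=
  SF2R (a11 A) - SF2R (a22 A) = 0 -> scalar_C (a21 A) <> RtoC 0 ->
  signbit fl_a = false.
End Computed.

(* Main.v *)
Require Import Defs.
From Stdlib Require Import Reals ZArith SpecFloat Lra Lia Psatz.
From Coquelicot Require Import Coquelicot.
Open Scope R_scope.

(** Why the proposition holds.

    Write [u = eps F].  Every operation is shown to deliver a representable number
    nearest to its exact result, or an infinity of the right sign when that result
    exceeds [nu] ([fadd_rounds], [fmul_rounds], [fdiv_rounds], [fsqrt_rounds],
    [fma_rounds]).  Both the error bounds and the exclusion of overflow follow from
    this property.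

    Accuracy is tracked multiplicatively.  [near K x y] says that [y / x] lies
    between [1 / K] and [K].  Factors multiply along products and quotients, a
    square root takes [K * K] to [K], and adding 1 to a nonnegative number or
    passing to the tangent of the half angle does not increase the factor
    ([near_succ], [near_half_tan]).  A rounding contributes [1 + u] when the exact
    result is normal ([nearest_normal]); this is symmetric because the error is at
    most [u / (1 + u)] times the exact result.  When only the rounded result is
    known to be normal, as with the hypothesis on underflow, the contribution is
    [1 / (1 - u)] ([nearest_normal_result]), because a number just below the least
    normal one may be rounded up to it.

    The factors that accumulate are
    - [(1+u)^2 (1+u^2) / (1-u)] for the modulus of a complex [a21]: an error in
      [q <= 1] counts only half in [sqrt (1 + q^2)] ([near_succ_sqr]);
    - one more division, hence [1 + 4u + 9u^2 + ...], for its argument;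
    - [(1+u)^3 (1+u/2) / (1-u)^2 = 1 + 5.5u + 14.5u^2 + ...] for the tangent in the
      real case, of which the difference of the diagonal entries and the quotient
      give two units, the square root of the fused multiply-add one and a half, the
      sum and the last quotient two;
    - a further [(1+u/2) (1+u)^2] for the cosine, hence [1 + 8u + 30.25u^2 + ...].
    If [K = 1 + c u + k u^2 + ...] then [1 / K > 1 - c u] as soon as [k < c^2], so
    that the lower bounds are strict, and the upper bounds hold because
    [k u < 10^(-6)] (twice that for the cosine) when [u <= 2^(-24)].  In the complex
    case the tangent takes 8.5 units and the cosine 11, well below the claim.

    When the quotient [tan (2 phi)] is replaced by the rounded [sqrt nu], the exact
    one is infinite or at least a quarter of this, and both tangents of the half
    angle differ from 1 by at most [u].

    Nothing overflows because the entries are at most [nu / 5.6] and the computed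
    tangent is at most 1.01 in magnitude, which bounds the numerators of the
    eigenvalues by [5 nu / 5.6] ([eigenvalue_fp]); and because the rounded square
    root of [nu] is the predecessor of a power of two, whose square plus 1 is at
    most [nu] ([cap_value]). *)

Local Notation b2 := (powerRZ 2).

(** * Powers of two and digit counts *)

Lemma b2_gt0 e : 0 < b2 e.
Proof. apply powerRZ_lt; lra. Qed.

Lemma b2_add e f : b2 (e + f) = b2 e * b2 f.
Proof. apply powerRZ_add; lra. Qed.

Lemma b2_IZR e : (0 <= e)%Z -> b2 e = IZR (2 ^ e).
Proof.
  intros He; destruct e as [|e|e]; try lia.
  - reflexivity.
  - simpl Z.pow. now rewrite Zpower_pos_powerRZ.
Qed.

Lemma b2_oppM e : b2 e * b2 (- e) = 1.
Proof. rewrite <- b2_add, Z.add_opp_diag_r; reflexivity. Qed.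

Lemma b2_le e f : (e <= f)%Z -> b2 e <= b2 f.
Proof.
  intros H. replace f with (e + (f - e))%Z by ring.
  rewrite b2_add, (b2_IZR (f - e)) by lia.
  assert (1 <= IZR (2 ^ (f - e))) by (apply IZR_le; lia).
  pose proof (b2_gt0 e); nra.
Qed.

Lemma b2_succ e : b2 (e + 1) = 2 * b2 e.
Proof. rewrite b2_add; simpl; lra. Qed.

Lemma b2_lt e f : (e < f)%Z -> b2 e < b2 f.
Proof.
  intros H. apply Rlt_le_trans with (b2 (e + 1)).
  - rewrite b2_succ; pose proof (b2_gt0 e); lra.
  - apply b2_le; lia.
Qed.

Lemma b2_lt_inv e f : b2 e < b2 f -> (e < f)%Z.
Proof.
  intros H; destruct (Z_lt_le_dec e f) as [|Hle]; [assumption|].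
  apply b2_le in Hle; lra.
Qed.

Lemma digits2_pos_bounds m :
  (2 ^ (Z.pos (digits2_pos m) - 1) <= Z.pos m < 2 ^ Z.pos (digits2_pos m))%Z.
Proof.
  induction m as [m IH|m IH|]; simpl digits2_pos; try (simpl; lia);
    rewrite Pos2Z.inj_succ, Z.pow_succ_r by lia;
    replace (Z.succ (Z.pos (digits2_pos m)) - 1)%Z
      with (Z.succ (Z.pos (digits2_pos m) - 1)) by ring;
    rewrite Z.pow_succ_r by lia; lia.
Qed.

Lemma digits2_magnitude m e :
  b2 (Z.pos (digits2_pos m) + e - 1) <= IZR (Z.pos m) * b2 e
    < b2 (Z.pos (digits2_pos m) + e).
Proof.
  destruct (digits2_pos_bounds m) as [L U].
  apply IZR_le in L; apply IZR_lt in U.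
  rewrite <- b2_IZR in L, U by lia.
  replace (Z.pos (digits2_pos m) + e - 1)%Z
    with (Z.pos (digits2_pos m) - 1 + e)%Z by ring.
  rewrite !b2_add; pose proof (b2_gt0 e); nra.
Qed.

Lemma digits2_le m n : (Z.pos m < 2 ^ n)%Z -> (Z.pos (digits2_pos m) <= n)%Z.
Proof.
  intros H; destruct (digits2_pos_bounds m) as [L _].
  destruct (Z_lt_le_dec n 0) as [Hn|Hn]; [rewrite Z.pow_neg_r in H; lia|].
  assert (2 ^ (Z.pos (digits2_pos m) - 1) < 2 ^ n)%Z by lia.
  apply Z.pow_lt_mono_r_iff in H0; lia.
Qed.

Lemma digits2_ge m n :
  (2 ^ n <= Z.pos m)%Z -> (n < Z.pos (digits2_pos m))%Z.
Proof.
  intros H; destruct (digits2_pos_bounds m) as [_ U].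
  assert (2 ^ n < 2 ^ Z.pos (digits2_pos m))%Z by lia.
  apply Z.pow_lt_mono_r_iff in H0; lia.
Qed.

(** * Shifting a significand to the right *)

(** The position of [x] relative to the integer [m], the information that the guard
    and sticky bits of a right shift retain. *)
Definition located (m : Z) (l : location) (x : R) : Prop :=
  match l with
  | loc_Exact => x = IZR m
  | loc_Inexact c =>
      IZR m < x < IZR m + 1 /\
      match c with
      | Lt => x < IZR m + / 2
      | Eq => x = IZR m + / 2
      | Gt => IZR m + / 2 < x
      end
  end.

Lemma located_floor m l x : located m l x -> IZR m <= x < IZR m + 1.
Proof. destruct l as [|c]; simpl; lra. Qed.

Definition shr_located (mrs : shr_record) (x : R) : Prop :=
  (0 <= shr_m mrs)%Z /\ located (shr_m mrs) (loc_of_shr_record mrs) x.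

Lemma shr_1_located mrs x :
  shr_located mrs x -> shr_located (shr_1 mrs) (x / 2).
Proof.
  destruct mrs as [m r s]; intros [Hm Hx]; simpl in Hm, Hx.
  destruct m as [|m|m]; [| |lia].
  - split; [simpl; lia|].
    destruct r, s; simpl in *; lra.
  - destruct m as [m|m|]; (split; [simpl; lia|]).
    + assert (D : IZR (Z.pos m~1) = 2 * IZR (Z.pos m) + 1)
        by (rewrite (Pos2Z.inj_xI m), plus_IZR, mult_IZR; reflexivity).
      destruct r, s; cbn -[IZR] in *; rewrite D in Hx; lra.
    + assert (D : IZR (Z.pos m~0) = 2 * IZR (Z.pos m))
        by (rewrite (Pos2Z.inj_xO m), mult_IZR; reflexivity).
      destruct r, s; cbn -[IZR] in *; rewrite D in Hx; lra.
    + destruct r, s; cbn -[IZR] in *; lra.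
Qed.

Lemma iter_shr_1_located n mrs x :
  shr_located mrs x -> shr_located (iter_pos shr_1 n mrs) (x * b2 (- Z.pos n)).
Proof.
  revert mrs x; induction n as [n IH|n IH|]; intros mrs x H; simpl iter_pos.
  - replace (x * b2 (- Z.pos n~1)) with
      (x / 2 * b2 (- Z.pos n) * b2 (- Z.pos n)).
    + now apply IH, IH, shr_1_located.
    + replace (- Z.pos n~1)%Z with (- Z.pos n + - Z.pos n + - 1)%Z by lia.
      rewrite !b2_add; simpl (b2 (-1)); field.
  - replace (x * b2 (- Z.pos n~0)) with
      (x * b2 (- Z.pos n) * b2 (- Z.pos n)).
    + now apply IH, IH.
    + replace (- Z.pos n~0)%Z with (- Z.pos n + - Z.pos n)%Z by lia.
      rewrite !b2_add; ring.
  - replace (x * b2 (- Z.pos 1)) with (x / 2) by (simpl; field).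
    now apply shr_1_located.
Qed.

Lemma shr_located_spec mrs e n x :
  shr_located mrs (x * b2 (- e)) -> (0 <= n)%Z ->
  snd (shr mrs e n) = (e + n)%Z /\
  shr_located (fst (shr mrs e n)) (x * b2 (- (e + n))).
Proof.
  intros H Hn; destruct n as [|n|n]; [| |lia].
  - simpl; now rewrite Z.add_0_r.
  - simpl; split; [reflexivity|].
    replace (- (e + Z.pos n))%Z with (- e + - Z.pos n)%Z by ring.
    rewrite b2_add, <- Rmult_assoc.
    now apply iter_shr_1_located.
Qed.

Lemma round_nearest_even_half m l x :
  located m l x -> (m <= round_nearest_even m l <= m + 1)%Z /\
  Rabs (IZR (round_nearest_even m l) - x) <= / 2.
Proof.
  intros H; split.
  - destruct l as [|[| |]]; simpl; try destruct (Z.even m); lia.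
  - destruct l as [|[| |]]; simpl in *; try destruct (Z.even m);
      rewrite ?plus_IZR; apply Rabs_le; lra.
Qed.

(** * Rounding to nearest *)

(** The hypotheses under which the operations round correctly: at least two bits, and an
    exponent range larger than the precision, so that the subnormal threshold is
    negative and [1] is a normal number. *)
Class sound_format (F : format) : Prop := {
  one_lt_prec : (1 < prec F)%Z;
  prec_lt_emax : (prec F < emax F)%Z
}.

Section Rounding.
Context (F : format) {SF : sound_format F}.
Local Notation p := (prec F).
Local Notation E := (emax F).
Local Notation em := (emin p E).
Local Notation fexpF := (fexp p E).
Let Hp : (1 < p)%Z := one_lt_prec.
Let HE : (p < E)%Z := prec_lt_emax.

(** The numbers of the format without an upper limit on the exponent.  Being nearest
    among them is what characterizes a rounding, overflow being decided afterwards. *)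
Definition representable (z : R) : Prop :=
  exists k j : Z, z = IZR k * b2 j /\ (Z.abs k < 2 ^ p)%Z /\ (em <= j)%Z.

Definition nearest (x y : R) : Prop :=
  representable y /\ forall z, representable z -> Rabs (y - x) <= Rabs (z - x).

(** An infinity records that the exact result exceeds [nu]; a quotient that overflows
    before it is capped is treated by means of this. *)
Definition rounds (x : R) (y : spec_float) : Prop :=
  (fp_number F y /\ nearest x (SF2R y)) \/
  (SF2R (nu F) < x /\ y = S754_infinity false) \/
  (x < - SF2R (nu F) /\ y = S754_infinity true).

Lemma representable_opp z : representable z -> representable (- z).
Proof.
  intros (k & j & -> & Hk & Hj); exists (- k)%Z, j.
  rewrite opp_IZR; repeat split; [ring|lia|assumption].
Qed.

Lemma nearest_opp x y : nearest x y -> nearest (- x) (- y).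
Proof.
  intros [Hy H]; split; [now apply representable_opp|].
  intros z Hz; apply representable_opp, H in Hz.
  rewrite <- (Rabs_Ropp (- y - - x)), <- (Rabs_Ropp (z - - x)).
  replace (- (- y - - x)) with (y - x) by ring.
  now replace (- (z - - x)) with (- z - x) by ring.
Qed.

(** An integer within one half of [x] is a nearest one, so that the rounded significand
    need only be located to within one half. *)
Lemma nearest_int (x : R) (n k : Z) :
  Rabs (IZR n - x) <= / 2 -> Rabs (IZR n - x) <= Rabs (IZR k - x).
Proof.
  intros H; destruct (Z.eq_dec n k) as [->|Hnk]; [lra|].
  apply Rle_trans with (1 := H).
  apply Rabs_le_between in H.
  destruct (Z_lt_le_dec n k) as [Hl|Hl].
  - assert (IZR n + 1 <= IZR k) by (rewrite <- plus_IZR; apply IZR_le; lia).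
    rewrite Rabs_pos_eq; lra.
  - assert (IZR k + 1 <= IZR n) by (rewrite <- plus_IZR; apply IZR_le; lia).
    rewrite <- Rabs_Ropp, Rabs_pos_eq; lra.
Qed.

(** It suffices to be nearest among the multiples of [2 ^ e], where [e] is the exponent of
    the binade of [x]: representable numbers off this grid have a smaller exponent,
    hence lie below the binade. *)
Lemma nearest_on_grid x n e :
  0 <= x -> (em <= e)%Z -> (Z.abs n <= 2 ^ p)%Z ->
  (e = em \/ b2 (p - 1) <= x * b2 (- e)) ->
  Rabs (IZR n - x * b2 (- e)) <= / 2 ->
  nearest x (IZR n * b2 e).
Proof.
  intros Hx He Hn Hnormal Hhalf.
  assert (P := b2_gt0 e).
  assert (X : x = x * b2 (- e) * b2 e)
    by (rewrite Rmult_assoc, (Rmult_comm (b2 (- e))), b2_oppM; ring).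
  set (x1 := x * b2 (- e)) in *.
  split.
  - destruct (Z.eq_dec (Z.abs n) (2 ^ p)) as [Hpow|Hne].
    + exists (n / 2)%Z, (e + 1)%Z.
      assert (Hev : (n = 2 * (n / 2))%Z).
      { apply Z_div_exact_full_2; [lia|].
        assert (2 ^ p = 2 * 2 ^ (p - 1))%Z
          by (rewrite <- Z.pow_succ_r by lia; f_equal; lia).
        destruct (Z.abs_eq_or_opp n) as [Ha|Ha].
        - replace n with (2 ^ (p - 1) * 2)%Z by lia; apply Z_mod_mult.
        - replace n with (- 2 ^ (p - 1) * 2)%Z by lia; apply Z_mod_mult. }
      split; [|lia].
      rewrite Hev at 1; rewrite b2_succ, mult_IZR; ring.
    + exists n, e; repeat split; lia.
  - intros z (k & j & -> & Hk & Hj).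
    assert (G : forall w, Rabs (w * b2 e - x) = Rabs (w - x1) * b2 e).
    { intros w; rewrite X, <- Rmult_minus_distr_r, Rabs_mult.
      now rewrite (Rabs_pos_eq (b2 e)) by lra. }
    rewrite G.
    destruct (Z_le_gt_dec e j) as [Hej|Hej].
    + replace (IZR k * b2 j) with (IZR (k * 2 ^ (j - e)) * b2 e).
      * rewrite G; apply Rmult_le_compat_r; [lra|]; now apply nearest_int.
      * rewrite mult_IZR, <- b2_IZR by lia.
        rewrite Rmult_assoc, <- b2_add; do 2 f_equal; ring.
    + destruct Hnormal as [->|Hnormal]; [lia|].
      (* a number with a smaller exponent is at most the lower end of the binade of [x] *)
      assert (Hz : IZR k * b2 j <= IZR (2 ^ (p - 1)) * b2 e).
      { apply Rle_trans with (b2 (p + j)).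
        - rewrite b2_add, (b2_IZR p) by lia.
          apply Rmult_le_compat_r; [apply Rlt_le, b2_gt0|apply IZR_le; lia].
        - rewrite <- b2_IZR, <- b2_add by lia; apply b2_le; lia. }
      apply Rle_trans with (Rabs (IZR (2 ^ (p - 1)) * b2 e - x)).
      * rewrite G; apply Rmult_le_compat_r; [lra|]; now apply nearest_int.
      * rewrite <- b2_IZR in * by lia.
        assert (b2 (p - 1) * b2 e <= x) by (rewrite X; nra).
        rewrite <- (Rabs_Ropp (b2 _ * _ - _)), <- (Rabs_Ropp (IZR k * _ - _)).
        rewrite !Rabs_pos_eq; lra.
Qed.

Lemma shr_fexp_located m e l x :
  (0 <= m)%Z -> located m l (x * b2 (- e)) ->
  (e <= fexpF (Zdigits2 m + e))%Z ->
  snd (shr_fexp p E m e l) = fexpF (Zdigits2 m + e) /\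
  shr_located (fst (shr_fexp p E m e l)) (x * b2 (- fexpF (Zdigits2 m + e))).
Proof.
  intros Hm Hl He; unfold shr_fexp.
  pose proof (shr_located_spec (shr_record_of_loc m l) e
    (fexpF (Zdigits2 m + e) - e) x) as S.
  rewrite Zplus_minus in S; apply S; [|lia].
  destruct l as [|[| |]]; split; assumption.
Qed.

(** Normal numbers have exactly [prec] digits, subnormal ones the least exponent. *)
Lemma canonical_of_bounds m e :
  (Z.pos m < 2 ^ p)%Z -> (em <= e)%Z -> (e = em \/ 2 ^ (p - 1) <= Z.pos m)%Z ->
  fexpF (Z.pos (digits2_pos m) + e) = e.
Proof.
  intros H1 He H2; apply digits2_le in H1.
  unfold fexp in *; destruct H2 as [->|H2]; [lia|].
  apply digits2_ge in H2; lia.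
Qed.

(** Rounding up may carry into a new binade, and only by reaching the power of two
    itself; the second shift then drops a zero bit and is exact. *)
Lemma shr_fexp_carry m e :
  (0 <= m <= 2 ^ p)%Z -> (em <= e)%Z -> (e = em \/ 2 ^ (p - 1) <= m)%Z ->
  exists m' e', shr_m (fst (shr_fexp p E m e loc_Exact)) = m' /\
    snd (shr_fexp p E m e loc_Exact) = e' /\
    IZR m' * b2 e' = IZR m * b2 e /\ (0 <= m' < 2 ^ p)%Z /\ (em <= e')%Z /\
    (e' = em \/ 2 ^ (p - 1) <= m')%Z.
Proof.
  intros Hm He Hn.
  assert (P2 : (2 ^ p = 2 * 2 ^ (p - 1))%Z)
    by (rewrite <- Z.pow_succ_r by lia; f_equal; lia).
  destruct (Z.eq_dec m (2 ^ p)) as [->|Hne].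
  - assert (D : Zdigits2 (2 ^ p) = (p + 1)%Z).
    { assert (0 < 2 ^ p)%Z by lia.
      assert (2 ^ (p + 1) = 2 * 2 ^ p)%Z
        by (rewrite Z.add_1_r, Z.pow_succ_r; lia).
      destruct (2 ^ p)%Z as [|q|q] eqn:Q; try lia; simpl.
      apply Z.le_antisymm.
      - apply digits2_le; lia.
      - enough (p < Z.pos (digits2_pos q))%Z by lia.
        apply digits2_ge; lia. }
    assert (Fe : fexpF (Zdigits2 (2 ^ p) + e) = (e + 1)%Z)
      by (rewrite D; unfold fexp; lia).
    destruct (shr_fexp_located (2 ^ p) e loc_Exact (IZR (2 ^ p) * b2 e))
      as [S1 [S2 S3]].
    + lia.
    + simpl; rewrite Rmult_assoc, b2_oppM; ring.
    + lia.
    + rewrite Fe in *.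
      set (mrs := fst _) in *.
      assert (Hm' : shr_m mrs = (2 ^ (p - 1))%Z).
      { apply located_floor in S3.
        replace (IZR (2 ^ p) * b2 e * b2 (- (e + 1))) with (IZR (2 ^ (p - 1))) in S3.
        - destruct S3 as [S3 S4]; rewrite <- plus_IZR in S4.
          apply le_IZR in S3; apply lt_IZR in S4; lia.
        - rewrite <- !b2_IZR, <- !b2_add by lia; f_equal; ring. }
      exists (2 ^ (p - 1))%Z, (e + 1)%Z; repeat split; try assumption; try lia.
      rewrite b2_succ, P2, mult_IZR; ring.
  - exists m, e.
    assert (shr_fexp p E m e loc_Exact = (Build_shr_record m false false, e)) as ->.
    { assert (fexpF (Zdigits2 m + e) <= e)%Z.
      { destruct m as [|m|m]; [unfold fexp; simpl Zdigits2; lia| |lia].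
        change (Zdigits2 (Z.pos m)) with (Z.pos (digits2_pos m)).
        rewrite canonical_of_bounds; lia. }
      unfold shr_fexp, shr.
      destruct (fexpF (Zdigits2 m + e) - e)%Z eqn:?; try lia; reflexivity. }
    simpl; repeat split; try reflexivity; try assumption; lia.
Qed.

Lemma Pos_iter_xO n m : Z.pos (Pos.iter xO m n) = (Z.pos m * 2 ^ Z.pos n)%Z.
Proof.
  change (Pos.iter xO m n) with (Zpower.shift_pos n m).
  rewrite Zpower.shift_pos_correct, Z.mul_comm; reflexivity.
Qed.

Lemma nu_value : SF2R (nu F) = (b2 p - 1) * b2 (E - p).
Proof.
  unfold nu, SFmax_float, SF2R; cbn [cond_Zopp].
  pose proof (Pos_iter_xO (Z.to_pos p) 1) as Q.
  rewrite Z2Pos.id, Z.mul_1_l in Q by lia.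
  assert (2 <= 2 ^ p)%Z by (change 2%Z with (2 ^ 1)%Z at 1; apply Z.pow_le_mono_r; lia).
  f_equal; rewrite b2_IZR, <- Q, <- minus_IZR by lia; f_equal.
  apply Pos2Z.inj_sub; lia.
Qed.

Lemma nu_fp : fp_number F (nu F).
Proof.
  split; [exact I|]; unfold nu, SFmax_float; simpl valid_binary.
  pose proof (Pos_iter_xO (Z.to_pos p) 1) as Q.
  rewrite Z2Pos.id, Z.mul_1_l in Q by lia.
  assert (2 <= 2 ^ p)%Z by (change 2%Z with (2 ^ 1)%Z at 1; apply Z.pow_le_mono_r; lia).
  assert (2 ^ p = 2 * 2 ^ (p - 1))%Z
    by (rewrite <- Z.pow_succ_r by lia; f_equal; lia).
  unfold bounded, canonical_mantissa.
  rewrite canonical_of_bounds.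
  - rewrite Z.eqb_refl, Z.leb_refl; reflexivity.
  - rewrite Pos2Z.inj_sub; lia.
  - unfold emin; lia.
  - right; rewrite Pos2Z.inj_sub; lia.
Qed.

Lemma SF2R_opp x : SF2R (SFopp x) = - SF2R x.
Proof.
  destruct x as [s|s| |s m e]; simpl; try ring.
  destruct s; simpl; rewrite ?Pos2Z.opp_pos, <- ?Pos2Z.opp_pos, ?opp_IZR; ring.
Qed.

Lemma fp_opp x : fp_number F x -> fp_number F (SFopp x).
Proof. destruct x; simpl; auto. Qed.

Lemma fp_representable x : fp_number F x -> representable (SF2R x).
Proof.
  intros [Hf Hv]; destruct x as [s|s| |s m e]; try contradiction.
  - exists 0%Z, em; repeat split; [simpl; ring|lia|lia].
  - simpl in Hv; apply andb_prop in Hv; destruct Hv as [Hc _].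
    apply Z.eqb_eq in Hc; unfold fexp in Hc.
    pose proof (digits2_pos_bounds m) as [_ U].
    assert (2 ^ Z.pos (digits2_pos m) <= 2 ^ p)%Z
      by (apply Z.pow_le_mono_r; lia).
    exists (cond_Zopp s (Z.pos m)), e; repeat split; [|lia].
    destruct s; simpl; lia.
Qed.

Lemma rounds_opp x y : rounds x y -> rounds (- x) (SFopp y).
Proof.
  intros [[Hf Hn]|[[H ->]|[H ->]]].
  - left; split; [now apply fp_opp|]; rewrite SF2R_opp; now apply nearest_opp.
  - right; right; split; [lra|reflexivity].
  - right; left; split; [lra|reflexivity].
Qed.

Lemma binary_round_aux_opp m e l :
  binary_round_aux p E true m e l = SFopp (binary_round_aux p E false m e l) \/
  binary_round_aux p E false m e l = S754_nan.
Proof.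
  unfold binary_round_aux.
  destruct (shr_fexp p E m e l) as [mrs e'].
  destruct (shr_fexp p E _ e' loc_Exact) as [mrs' e''].
  destruct (shr_m mrs') as [|k|k]; [now left| |now right].
  left; destruct (e'' <=? E - p)%Z; reflexivity.
Qed.

(** The hypothesis on [e] says that the significand is not too short: at least [prec]
    bits are known, or the exponent is the least one.  The location then tells how
    the part shifted out compares with one half. *)
Lemma binary_round_aux_rounds (s : bool) m e l x :
  0 <= x -> (0 <= m)%Z -> located m l (x * b2 (- e)) ->
  (e <= fexpF (Zdigits2 m + e))%Z ->
  rounds (if s then - x else x) (binary_round_aux p E s m e l).
Proof.
  intros Hx Hm Hl He.
  enough (H : rounds x (binary_round_aux p E false m e l)).
  { destruct s; [|exact H].
    destruct (binary_round_aux_opp m e l) as [->|N]; [now apply rounds_opp|].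
    rewrite N in H; destruct H as [[[[] _] _]|[[_ H]|[_ H]]]; discriminate. }
  destruct (shr_fexp_located m e l x Hm Hl He) as [He1 [Hm1 Hl1]].
  unfold binary_round_aux.
  destruct (shr_fexp p E m e l) as [mrs e1]; cbn [fst snd] in *.
  set (D := (Zdigits2 m + e)%Z) in *.
  assert (X : x = x * b2 (- e) * b2 e)
    by (rewrite Rmult_assoc, (Rmult_comm (b2 (- e))), b2_oppM; ring).
  apply located_floor in Hl.
  assert (Hup : x < b2 D).
  { rewrite X; apply Rlt_le_trans with ((IZR m + 1) * b2 e).
    - pose proof (b2_gt0 e); nra.
    - unfold D; rewrite b2_add.
      apply Rmult_le_compat_r; [apply Rlt_le, b2_gt0|].
      rewrite <- plus_IZR; destruct m as [|m|m]; [|clear -Hm|lia].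
      + simpl; lra.
      + change (Zdigits2 (Z.pos m)) with (Z.pos (digits2_pos m)).
        rewrite b2_IZR by easy.
        apply IZR_le; pose proof (digits2_pos_bounds m); lia. }
  assert (Hlow : e1 = em \/ b2 (p - 1) <= x * b2 (- e1)).
  { destruct m as [|m|m]; [left| |lia].
    - subst e1; unfold D, fexp in *; simpl in *; lia.
    - destruct (Z.eq_dec e1 em); [now left|right].
      apply Rle_trans with (b2 (D - 1) * b2 (- e1)).
      + rewrite <- b2_add; apply b2_le.
        unfold fexp in He1; lia.
      + apply Rmult_le_compat_r; [apply Rlt_le, b2_gt0|].
        apply Rle_trans with (IZR (Z.pos m) * b2 e).
        * apply digits2_magnitude.
        * rewrite X; apply Rmult_le_compat_r; [apply Rlt_le, b2_gt0|lra]. }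
  assert (Hup1 : x * b2 (- e1) < IZR (2 ^ p)).
  { rewrite <- b2_IZR by lia; apply Rlt_le_trans with (b2 D * b2 (- e1)).
    - apply Rmult_lt_compat_r; [apply b2_gt0|assumption].
    - rewrite <- b2_add; apply b2_le; unfold fexp in He1; lia. }
  destruct (round_nearest_even_half _ _ _ Hl1) as [Hr Hhalf].
  rewrite <- He1 in Hl1, Hhalf.
  apply located_floor in Hl1.
  set (m1 := shr_m mrs) in *.
  set (m2 := round_nearest_even m1 _) in *.
  assert (Hm1p : (m1 < 2 ^ p)%Z) by (apply lt_IZR; lra).
  assert (Hem : (em <= e1)%Z) by (unfold fexp in He1; lia).
  assert (Hm1l : (e1 = em \/ 2 ^ (p - 1) <= m1)%Z).
  { destruct Hlow as [|Hlow]; [now left|right].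
    rewrite b2_IZR in Hlow by lia.
    apply Z.lt_succ_r, lt_IZR; rewrite succ_IZR; lra. }
  assert (Hnear : nearest x (IZR m2 * b2 e1))
    by (apply nearest_on_grid; auto; lia).
  destruct (shr_fexp_carry m2 e1) as (m3 & e3 & M3 & E3 & V & B & Em3 & N3);
    [lia|lia|lia|].
  destruct (shr_fexp p E m2 e1 loc_Exact) as [mrs3 e3'].
  cbn [fst snd] in M3, E3; subst e3'; rewrite M3, <- V in *; clear M3.
  destruct m3 as [|m3|m3]; [| |lia].
  - left; repeat split; try exact I; simpl.
    + destruct Hnear; now rewrite Rmult_0_l in H.
    + destruct Hnear; now rewrite Rmult_0_l in H0.
  - destruct (Z.leb_spec e3 (E - p)) as [Hov|Hov].
    + left; split; [|exact Hnear].
      split; [exact I|]; simpl; unfold bounded, canonical_mantissa.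
      rewrite canonical_of_bounds by lia.
      rewrite Z.eqb_refl; simpl; now apply Z.leb_le.
    + right; left; split; [|reflexivity].
      (* the rounded value is at least [2 ^ emax], yet no farther from [x] than [nu] *)
      apply Rnot_le_lt; intros Hle.
      destruct Hnear as [_ Hnear].
      specialize (Hnear _ (fp_representable _ nu_fp)).
      assert (b2 (p - 1) * b2 (E - p + 1) <= IZR (Z.pos m3) * b2 e3).
      { apply Rmult_le_compat; try (apply Rlt_le, b2_gt0).
        - rewrite b2_IZR by lia; apply IZR_le; unfold emin in N3; lia.
        - apply b2_le; lia. }
      rewrite <- b2_add in H.
      replace (p - 1 + (E - p + 1))%Z with (p + (E - p))%Z in H by ring.
      rewrite nu_value, b2_add in *; pose proof (b2_gt0 (E - p)).
      rewrite Rabs_pos_eq, Rabs_pos_eq in Hnear by nra; nra.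
Qed.

End Rounding.

(** * Correct rounding of the operations *)

Section Operations.
Context (F : format) {SF : sound_format F}.
Local Notation p := (prec F).
Local Notation E := (emax F).
Local Notation em := (emin p E).
Local Notation fexpF := (fexp p E).
Let Hp : (1 < p)%Z := one_lt_prec.
Let HE : (p < E)%Z := prec_lt_emax.

Lemma rounds_exact x : fp_number F x -> rounds F (SF2R x) x.
Proof.
  intros H; left; split; [assumption|split].
  - now apply fp_representable.
  - intros z _; unfold Rminus at 1; rewrite Rplus_opp_r, Rabs_R0; apply Rabs_pos.
Qed.

Lemma SF2R_finite s m e :
  SF2R (S754_finite s m e)
  = if s then - (IZR (Z.pos m) * b2 e) else IZR (Z.pos m) * b2 e.
Proof. destruct s; unfold SF2R, cond_Zopp; rewrite ?opp_IZR; ring. Qed.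

Lemma shl_align_value m e e' :
  IZR (Z.pos (fst (shl_align m e e'))) * b2 (Z.min e e')
    = IZR (Z.pos m) * b2 e /\
  snd (shl_align m e e') = Z.min e e'.
Proof.
  unfold shl_align; destruct (e' - e)%Z eqn:D; simpl fst; simpl snd.
  - rewrite Z.min_l by lia; auto.
  - rewrite Z.min_l by lia; auto.
  - rewrite Z.min_r by lia; split; [|reflexivity].
    rewrite Pos_iter_xO, mult_IZR, <- b2_IZR, Rmult_assoc, <- b2_add by lia.
    do 2 f_equal; lia.
Qed.

(** A significand that is too short is first padded with zero bits, which changes neither
    the value nor the binade. *)
Lemma binary_round_rounds s m e :
  rounds F (SF2R (S754_finite s m e)) (binary_round p E s m e).
Proof.
  rewrite SF2R_finite; unfold binary_round.
  destruct (shl_align_value m e (fexpF (Z.pos (digits2_pos m) + e))) as [V S].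
  destruct (shl_align m e _) as [mz ez]; cbn [fst snd] in *; rewrite <- S in V.
  pose proof (digits2_magnitude m e) as M; rewrite <- V in M.
  pose proof (digits2_magnitude mz ez) as Mz.
  assert (D : (Z.pos (digits2_pos mz) + ez = Z.pos (digits2_pos m) + e)%Z).
  { assert (b2 (Z.pos (digits2_pos mz) + ez - 1) < b2 (Z.pos (digits2_pos m) + e))
      as A by lra; apply b2_lt_inv in A.
    assert (b2 (Z.pos (digits2_pos m) + e - 1) < b2 (Z.pos (digits2_pos mz) + ez))
      as B by lra; apply b2_lt_inv in B; lia. }
  rewrite <- V; apply binary_round_aux_rounds; auto.
  - pose proof (b2_gt0 ez); assert (0 <= IZR (Z.pos mz)) by (apply IZR_le; lia); nra.
  - lia.
  - simpl; rewrite Rmult_assoc, b2_oppM; ring.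
  - simpl Zdigits2; rewrite D; lia.
Qed.

Lemma binary_normalize_rounds m e s :
  rounds F (IZR m * b2 e) (binary_normalize p E m e s).
Proof.
  destruct m as [|m|m]; simpl binary_normalize.
  - rewrite Rmult_0_l; apply (rounds_exact (S754_zero s)); repeat split.
  - apply (binary_round_rounds false).
  - replace (IZR (Z.neg m) * b2 e) with (SF2R (S754_finite true m e)) by reflexivity.
    apply binary_round_rounds.
Qed.

Lemma cond_Zopp_align s m e e' :
  (e' <= e)%Z ->
  IZR (cond_Zopp s (Z.pos (fst (shl_align m e e')))) * b2 e'
  = SF2R (S754_finite s m e).
Proof.
  intros He; destruct (shl_align_value m e e') as [V _].
  rewrite Z.min_r in V by assumption.
  rewrite SF2R_finite, <- V; destruct s; unfold cond_Zopp; rewrite ?opp_IZR; ring.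
Qed.

Lemma fadd_rounds x y :
  fp_number F x -> fp_number F y -> rounds F (SF2R x + SF2R y) (fadd F x y).
Proof.
  intros Hx Hy.
  destruct x as [sx|sx| |sx mx ex]; try (now destruct Hx);
    destruct y as [sy|sy| |sy my ey]; try (now destruct Hy).
  - replace (_ + _) with 0 by (simpl; ring).
    destruct sx, sy; apply (rounds_exact (S754_zero _)); repeat split.
  - simpl (SF2R (S754_zero _)); rewrite Rplus_0_l; now apply rounds_exact.
  - simpl (SF2R (S754_zero _)); rewrite Rplus_0_r; now apply rounds_exact.
  - unfold fadd, SFadd.
    rewrite <- (cond_Zopp_align sx mx ex (Z.min ex ey)) by lia.
    rewrite <- (cond_Zopp_align sy my ey (Z.min ex ey)) by lia.
    rewrite <- Rmult_plus_distr_r, <- plus_IZR.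
    apply binary_normalize_rounds.
Qed.

Lemma fsub_rounds x y :
  fp_number F x -> fp_number F y -> rounds F (SF2R x - SF2R y) (fsub F x y).
Proof.
  intros Hx Hy; unfold Rminus; rewrite <- SF2R_opp.
  replace (fsub F x y) with (fadd F x (SFopp y)).
  - apply fadd_rounds; [assumption|now apply fp_opp].
  - destruct x as [sx|sx| |sx mx ex]; try (now destruct Hx);
      destruct y as [sy|sy| |sy my ey]; try (now destruct Hy);
      destruct sx, sy; reflexivity.
Qed.

Lemma canonical_cases s m e :
  fp_number F (S754_finite s m e) ->
  (em <= e <= E - p)%Z /\ (Z.pos (digits2_pos m) <= p)%Z /\
  (e = em \/ Z.pos (digits2_pos m) = p)%Z.
Proof.
  intros [_ H]; simpl in H; apply andb_prop in H; destruct H as [C B].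
  apply Z.eqb_eq in C; apply Z.leb_le in B; unfold fexp in C; lia.
Qed.

(** If either factor is normal, the product has at least [prec] digits; if both are
    subnormal, its exponent is at most the least one. *)
Lemma fmul_rounds x y :
  fp_number F x -> fp_number F y -> rounds F (SF2R x * SF2R y) (fmul F x y).
Proof.
  intros Hx Hy.
  destruct x as [sx|sx| |sx mx ex]; try (now destruct Hx);
    destruct y as [sy|sy| |sy my ey]; try (now destruct Hy);
    try (replace (_ * _) with 0 by (simpl; ring);
         apply (rounds_exact (S754_zero _)); repeat split).
  apply canonical_cases in Hx, Hy; unfold fmul, SFmul.
  replace (SF2R _ * SF2R _) with
    (if xorb sx sy then - (IZR (Z.pos (mx * my)) * b2 (ex + ey))
     else IZR (Z.pos (mx * my)) * b2 (ex + ey))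
    by (rewrite !SF2R_finite, Pos2Z.inj_mul, mult_IZR, b2_add;
        destruct sx, sy; cbn [xorb]; ring).
  apply binary_round_aux_rounds; auto.
  - apply Rmult_le_pos; [apply IZR_le; lia|apply Rlt_le, b2_gt0].
  - lia.
  - simpl; rewrite Rmult_assoc, b2_oppM; ring.
  - simpl Zdigits2.
    assert (Z.pos (digits2_pos mx) + Z.pos (digits2_pos my) - 2
            < Z.pos (digits2_pos (mx * my)))%Z.
    { apply digits2_ge.
      replace (Z.pos (digits2_pos mx) + Z.pos (digits2_pos my) - 2)%Z
        with (Z.pos (digits2_pos mx) - 1 + (Z.pos (digits2_pos my) - 1))%Z by ring.
      rewrite Z.pow_add_r, Pos2Z.inj_mul by lia.
      pose proof (digits2_pos_bounds mx); pose proof (digits2_pos_bounds my).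
      apply Z.mul_le_mono_nonneg; try lia; apply Z.pow_nonneg; lia. }
    unfold fexp, emin in *; lia.
Qed.

(** For an odd divisor the remainder is never one half of it, which is why the two parities
    are treated differently in [new_location]. *)
Lemma new_location_located n r q :
  (0 < n)%Z -> (0 <= r < n)%Z ->
  located q (new_location n r) (IZR q + IZR r / IZR n).
Proof.
  intros Hn Hr.
  assert (N : 0 < IZR n) by (apply IZR_lt; lia).
  assert (T : IZR r = IZR r / IZR n * IZR n) by (field; lra).
  assert (L : forall c, (r <> 0)%Z ->
    match c with
    | Lt => (2 * r < n)%Z | Eq => (2 * r = n)%Z | Gt => (n < 2 * r)%Z
    end -> located q (loc_Inexact c) (IZR q + IZR r / IZR n)).
  { intros c Hr0 Hc.
    assert (1 <= IZR r) by (apply IZR_le; lia).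
    assert (IZR r < IZR n) by (apply IZR_lt; lia).
    split; [split; nra|].
    destruct c; [apply IZR_eq in Hc|apply IZR_lt in Hc|apply IZR_lt in Hc];
      rewrite mult_IZR in Hc; nra. }
  assert (X : forall l, r = 0%Z -> l = loc_Exact ->
    located q l (IZR q + IZR r / IZR n))
    by (intros l -> ->; simpl; unfold Rdiv; ring).
  unfold new_location, new_location_even, new_location_odd.
  destruct (Z.even n) eqn:Ev; destruct (Z.eqb_spec r 0); auto; apply L; auto.
  - destruct (Z.compare_spec (2 * r) n); lia.
  - assert (2 * r <> n)%Z
      by (intros <-; rewrite Z.even_mul in Ev; discriminate).
    destruct (Z.compare_spec (2 * r + 1) n); lia.
Qed.

Lemma Zdigits2_upper q : (0 <= q)%Z -> (q + 1 <= 2 ^ Zdigits2 q)%Z.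
Proof.
  intros Hq; destruct q as [|q|q]; [simpl; lia| |lia].
  pose proof (digits2_pos_bounds q); simpl Zdigits2; lia.
Qed.

Lemma Zdigits2_nonneg q : (0 <= Zdigits2 q)%Z.
Proof. destruct q; simpl; lia. Qed.

Lemma fdiv_rounds x y :
  fp_number F x -> fp_number F y -> SF2R y <> 0 ->
  rounds F (SF2R x / SF2R y) (fdiv F x y).
Proof.
  intros Hx Hy Hy0.
  destruct y as [sy|sy| |sy my ey]; try (now destruct Hy).
  destruct x as [sx|sx| |sx mx ex]; try (now destruct Hx).
  { simpl (SF2R (S754_zero _)); unfold Rdiv; rewrite Rmult_0_l.
    apply (rounds_exact (S754_zero _)); repeat split. }
  clear Hx Hy Hy0; unfold fdiv, SFdiv, SFdiv_core_binary.
  set (e' := Z.min _ _).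
  set (m' := match (ex - ey - e')%Z with Zpos _ => _ | Z0 => _ | Zneg _ => _ end).
  assert (Hm' : m' = (Z.pos mx * 2 ^ (ex - ey - e'))%Z).
  { unfold m'; destruct (ex - ey - e')%Z eqn:D; [ring| |lia].
    rewrite Z.shiftl_mul_pow2; lia. }
  pose proof (Z_div_mod m' (Z.pos my) ltac:(lia)) as Q.
  destruct (Z.div_eucl m' (Z.pos my)) as [q r]; destruct Q as [Q R].
  assert (m'0 : (0 < m')%Z) by (rewrite Hm'; apply Z.mul_pos_pos; lia).
  assert (q0 : (0 <= q)%Z) by nia.
  assert (My : 0 < IZR (Z.pos my)) by (apply IZR_lt; lia).
  set (v := IZR (Z.pos mx) * b2 ex / (IZR (Z.pos my) * b2 ey)).
  assert (V0 : 0 < v).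
  { apply Rdiv_lt_0_compat; apply Rmult_lt_0_compat; auto using b2_gt0.
    apply IZR_lt; lia. }
  assert (V : v * b2 (- e') = IZR q + IZR r / IZR (Z.pos my)).
  { transitivity (IZR m' / IZR (Z.pos my)).
    - rewrite Hm', mult_IZR, <- b2_IZR by lia.
      unfold v, Zminus; rewrite !b2_add.
      replace (b2 (- ey)) with (/ b2 ey)
        by (rewrite powerRZ_neg'; reflexivity).
      pose proof (b2_gt0 ey); field; lra.
    - rewrite Q, plus_IZR, mult_IZR; field; lra. }
  replace (SF2R _ / SF2R _) with (if xorb sx sy then - v else v)
    by (rewrite !SF2R_finite; pose proof (b2_gt0 ey); unfold v;
        destruct sx, sy; cbn [xorb]; field; lra).
  assert (L := new_location_located (Z.pos my) r q ltac:(lia) R).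
  rewrite <- V in L.
  apply binary_round_aux_rounds; auto; [lra|].
  (* the quotient has at least [prec] digits, unless its exponent is the least one *)
  set (dd := (Zdigits2 (Z.pos mx) + ex - (Zdigits2 (Z.pos my) + ey))%Z) in *.
  enough (dd <= Zdigits2 q + e')%Z by (unfold fexp in *; lia).
  assert (B : b2 (dd - 1) < v).
  { pose proof (digits2_magnitude mx ex) as [Mx _].
    pose proof (digits2_magnitude my ey) as [_ My'].
    apply Rlt_div_r; [pose proof (b2_gt0 ey); nra|].
    replace (Z.pos (digits2_pos mx) + ex - 1)%Z
      with (dd - 1 + (Z.pos (digits2_pos my) + ey))%Z in Mx
      by (unfold dd; simpl Zdigits2; ring).
    rewrite b2_add in Mx; pose proof (b2_gt0 (dd - 1)); nra. }
  apply located_floor in L; destruct L as [_ L].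
  assert (b2 (dd - 1 - e') < b2 (Zdigits2 q)).
  { apply Rlt_le_trans with (IZR q + 1).
    - unfold Zminus at 1; rewrite b2_add.
      pose proof (b2_gt0 (- e')); nra.
    - rewrite b2_IZR, <- plus_IZR by apply Zdigits2_nonneg.
      apply IZR_le, Zdigits2_upper, q0. }
  apply b2_lt_inv in H; lia.
Qed.

(** The exponent is made even by the choice of [e'], after which the integer square root
    and its remainder locate the root: [r <= q] means [q^2 + r < (q + 1/2)^2]. *)
Lemma fsqrt_rounds x :
  fp_number F x -> 0 <= SF2R x -> rounds F (sqrt (SF2R x)) (fsqrt F x).
Proof.
  intros Hx Hx0.
  destruct x as [sx|sx| |sx m e]; try (now destruct Hx).
  { simpl (SF2R _); rewrite sqrt_0.
    apply (rounds_exact (S754_zero _)); repeat split. }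
  destruct sx.
  { rewrite SF2R_finite in Hx0; pose proof (b2_gt0 e).
    assert (0 < IZR (Z.pos m)) by (apply IZR_lt; lia); nra. }
  clear Hx Hx0; unfold fsqrt, SFsqrt, SFsqrt_core_binary.
  set (e' := Z.min _ _).
  assert (He' : (2 * e' <= e)%Z)
    by (pose proof (Zdiv2_odd_eqn e); unfold e'; destruct (Z.odd e); lia).
  set (m' := match (e - 2 * e')%Z with Zpos _ => _ | Z0 => _ | Zneg _ => _ end).
  assert (Hm' : m' = (Z.pos m * 2 ^ (e - 2 * e'))%Z).
  { unfold m'; destruct (e - 2 * e')%Z eqn:D; [ring| |lia].
    rewrite Z.shiftl_mul_pow2; lia. }
  assert (m'0 : (0 < m')%Z) by (rewrite Hm'; apply Z.mul_pos_pos; lia).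
  pose proof (Z.sqrtrem_spec m' ltac:(lia)) as Q.
  pose proof (Z.sqrtrem_sqrt m') as q0.
  destruct (Z.sqrtrem m') as [q r]; destruct Q as [Q R]; simpl in q0.
  assert (q1 : (0 <= q)%Z) by (subst q; apply Z.sqrt_nonneg); clear q0.
  set (v := sqrt (SF2R (S754_finite false m e))).
  assert (V : v * b2 (- e') = sqrt (IZR m')).
  { rewrite <- (sqrt_square (b2 (- e'))) by apply Rlt_le, b2_gt0.
    unfold v; rewrite <- sqrt_mult_alt.
    - f_equal; rewrite SF2R_finite, Hm', mult_IZR, <- b2_IZR, Rmult_assoc by lia.
      rewrite <- !b2_add; do 2 f_equal; ring.
    - rewrite SF2R_finite; apply Rmult_le_pos; [apply IZR_le; lia|apply Rlt_le, b2_gt0]. }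
  set (l := if (r =? 0)%Z then _ else _).
  assert (L : located q l (v * b2 (- e'))).
  { assert (W : sqrt (IZR m') * sqrt (IZR m') = IZR q * IZR q + IZR r)
      by (rewrite sqrt_sqrt, Q, plus_IZR, mult_IZR by (apply IZR_le; lia); ring).
    assert (Wp := sqrt_pos (IZR m')).
    assert (0 <= IZR q) by (apply IZR_le; lia).
    rewrite V; unfold l; destruct (Z.eqb_spec r 0) as [->|r0].
    - simpl in *; nra.
    - assert (1 <= IZR r) by (apply IZR_le; lia).
      assert (IZR r <= 2 * IZR q) by (rewrite <- mult_IZR; apply IZR_le; lia).
      split; [split; nra|].
      destruct (Z.leb_spec r q) as [rq|rq].
      + apply IZR_le in rq; nra.
      + assert (IZR q + 1 <= IZR r) by (rewrite <- plus_IZR; apply IZR_le; lia); nra. }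
  assert (v0 : 0 <= v) by apply sqrt_pos.
  apply (binary_round_aux_rounds F false); auto.
  set (dd := Z.div2 (Zdigits2 (Z.pos m) + e + 1)) in *.
  enough (dd <= Zdigits2 q + e')%Z by (unfold fexp in *; lia).
  assert (B : (2 ^ (Z.pos (digits2_pos m) - 1 + (e - 2 * e')) < 2 ^ (2 * Zdigits2 q))%Z).
  { pose proof (Zdigits2_upper q q1); pose proof (Zdigits2_nonneg q).
    replace (2 * Zdigits2 q)%Z with (Zdigits2 q + Zdigits2 q)%Z by ring.
    rewrite !Z.pow_add_r by lia.
    apply Z.le_lt_trans with m'; [|nia].
    rewrite Hm'; apply Z.mul_le_mono_nonneg_r; [apply Z.pow_nonneg; lia|].
    apply digits2_pos_bounds. }
  apply Z.pow_lt_mono_r_iff in B; [|lia|pose proof (Zdigits2_nonneg q); lia].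
  pose proof (Zdiv2_odd_eqn (Zdigits2 (Z.pos m) + e + 1)) as O.
  fold dd in O; simpl Zdigits2 in O; destruct (Z.odd _) in O; lia.
Qed.

(** When a factor is zero the product is exact, and otherwise the exact sum is formed before
    a single rounding. *)
Lemma fma_rounds x y z :
  fp_number F x -> fp_number F y -> fp_number F z ->
  rounds F (SF2R x * SF2R y + SF2R z) (fma F x y z).
Proof.
  intros Hx Hy Hz.
  assert (Z0 : SF2R x * SF2R y = 0 -> fp_number F (fmul F x y) ->
    SF2R (fmul F x y) = 0 -> rounds F (SF2R x * SF2R y + SF2R z)
      (fadd F (fmul F x y) z))
    by (intros -> Hm Hm0; rewrite <- Hm0; now apply fadd_rounds).
  destruct x as [sx|sx| |sx mx ex]; try (now destruct Hx);
    destruct y as [sy|sy| |sy my ey]; try (now destruct Hy);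
    try (apply Z0; [simpl; ring|repeat split|reflexivity]).
  clear Z0; destruct z as [sz|sz| |sz mz ez]; try (now destruct Hz).
  - simpl (SF2R (S754_zero _)); rewrite Rplus_0_r; now apply fmul_rounds.
  - unfold fma; set (e := Z.min (ex + ey) ez).
    replace (SF2R _ * SF2R _) with
      (SF2R (S754_finite (xorb sx sy) (mx * my) (ex + ey)))
      by (rewrite !SF2R_finite, Pos2Z.inj_mul, mult_IZR, b2_add;
          destruct sx, sy; cbn [xorb]; ring).
    rewrite <- (cond_Zopp_align _ (mx * my) (ex + ey) e) by (unfold e; lia).
    rewrite <- (cond_Zopp_align sz mz ez e) by (unfold e; lia).
    rewrite <- Rmult_plus_distr_r, <- plus_IZR.
    apply binary_normalize_rounds.
Qed.

End Operations.

(** * Relative error factors *)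

(** The factor is asked for, rather than a bound on [y / x], so that [near K 0 0] holds
    and the factors of the theorem can be read off. *)
Definition near (K x y : R) : Prop := exists d, y = d * x /\ / K <= d <= K.

Lemma near_exact K x : 1 <= K -> near K x x.
Proof.
  intros HK; exists 1; split; [ring|split; [|assumption]].
  rewrite <- Rinv_1; apply Rinv_le_contravar; lra.
Qed.

Lemma near_weaken K L x y : 0 < K <= L -> near K x y -> near L x y.
Proof.
  intros HK (d & -> & Hd); exists d; split; [reflexivity|].
  assert (/ L <= / K) by (apply Rinv_le_contravar; lra); lra.
Qed.

Lemma near_trans K L x y z :
  0 < K -> 0 < L -> near K x y -> near L y z -> near (K * L) x z.
Proof.
  intros HK HL (d & -> & Hd) (e & -> & He); exists (e * d); split; [ring|].
  assert (0 < / K) by now apply Rinv_0_lt_compat.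
  assert (0 < / L) by now apply Rinv_0_lt_compat.
  rewrite Rinv_mult, (Rmult_comm e); split; apply Rmult_le_compat; lra.
Qed.

Lemma near_mul K L x y x' y' :
  0 < K -> 0 < L -> near K x x' -> near L y y' -> near (K * L) (x * y) (x' * y').
Proof.
  intros HK HL (d & -> & Hd) (e & -> & He); exists (d * e); split; [ring|].
  assert (0 < / K) by now apply Rinv_0_lt_compat.
  assert (0 < / L) by now apply Rinv_0_lt_compat.
  rewrite Rinv_mult; split; apply Rmult_le_compat; lra.
Qed.

Lemma near_inv K x y : 0 < K -> near K x y -> near K (/ x) (/ y).
Proof.
  intros HK (d & -> & Hd); assert (0 < / K) by now apply Rinv_0_lt_compat.
  exists (/ d); rewrite Rinv_mult; split; [reflexivity|].
  rewrite <- (Rinv_inv K) at 2; split; apply Rinv_le_contravar; lra.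
Qed.

Lemma near_div K L x y x' y' :
  0 < K -> 0 < L -> near K x x' -> near L y y' -> near (K * L) (x / y) (x' / y').
Proof. intros; apply near_mul; auto using near_inv. Qed.

Lemma near_sqrt K x y :
  0 < K -> 0 <= x -> near (K * K) x y -> near K (sqrt x) (sqrt y).
Proof.
  intros HK Hx (d & -> & Hd).
  assert (0 < / K) by now apply Rinv_0_lt_compat.
  rewrite Rinv_mult in Hd.
  assert (0 <= d) by nra.
  exists (sqrt d); split; [now apply sqrt_mult|split].
  - rewrite <- (sqrt_square (/ K)) by lra; apply sqrt_le_1_alt; lra.
  - rewrite <- (sqrt_square K) by lra; apply sqrt_le_1_alt; lra.
Qed.

(** The ratio [(1 + d x) / (1 + x)] is a weighted mean of 1 and [d]. *)
Lemma near_succ K x y :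
  1 <= K -> 0 <= x -> near K x y -> near K (1 + x) (1 + y).
Proof.
  intros HK Hx (d & -> & Hd).
  assert (I1 : / K <= 1) by (rewrite <- Rinv_1; apply Rinv_le_contravar; lra).
  exists ((1 + d * x) / (1 + x)); split; [field; lra|split].
  - apply Rle_div_r; nra.
  - apply Rle_div_l; nra.
Qed.

(** * Accuracy of a rounding to nearest *)

Section Accuracy.
Context (F : format) {SF : sound_format F}.
Local Notation p := (prec F).
Local Notation E := (emax F).
Local Notation em := (emin p E).
Local Notation nearest := (nearest F).
Local Notation representable := (representable F).
Let Hp : (1 < p)%Z := one_lt_prec.
Let HE : (p < E)%Z := prec_lt_emax.

Lemma rounds_finite x y :
  rounds F x y -> Rabs x <= SF2R (nu F) -> fp_number F y /\ nearest x (SF2R y).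
Proof.
  intros H Hx; apply Rabs_le_between in Hx.
  destruct H as [H|[H|H]]; [assumption|lra|lra].
Qed.

Lemma nearest_le x y z : nearest x y -> representable z -> x <= z -> y <= z.
Proof.
  intros [_ H] Hz Hxz; apply H in Hz.
  apply Rnot_lt_le; intros Hlt; rewrite !Rabs_pos_eq in Hz; lra.
Qed.

Lemma nearest_ge x y z : nearest x y -> representable z -> z <= x -> z <= y.
Proof.
  intros H Hz Hxz; apply (nearest_opp F) in H; apply (representable_opp F) in Hz.
  apply Ropp_le_cancel, (nearest_le (- x) (- y) (- z)); auto; lra.
Qed.

(** Exact results of operations are recognized in this way, for instance [1 + 1] and
    [2 * fl(|a21|)]. *)
Lemma nearest_exact x y : nearest x y -> representable x -> y = x.
Proof.
  intros H Hx; apply Rle_antisym;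
    [apply (nearest_le x)|apply (nearest_ge x)]; auto; lra.
Qed.

Lemma representable_b2 e : (em <= e)%Z -> representable (b2 e).
Proof.
  intros He; exists 1%Z, e; repeat split; [simpl; ring| |assumption].
  pose proof (Z.pow_gt_1 2 p); lia.
Qed.

Lemma representable_0 : representable 0.
Proof. exists 0%Z, em; repeat split; [simpl; ring|simpl|]; lia. Qed.

Lemma nearest_refl_0 : nearest 0 0.
Proof.
  split; [apply representable_0|]; intros z _.
  rewrite Rminus_0_r, Rabs_R0; apply Rabs_pos.
Qed.

Lemma eps_b2 : eps F = b2 (- p).
Proof. reflexivity. Qed.

Lemma min_normal_b2 : min_normal F = b2 (em + p - 1).
Proof. unfold min_normal, emin; f_equal; ring. Qed.

Lemma nearest_error x y e :
  nearest x y -> 0 <= x <= b2 (e + p) -> (em <= e)%Z ->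
  Rabs (y - x) <= b2 (e - 1).
Proof.
  intros [_ H] Hx He.
  assert (P := b2_gt0 e).
  set (x1 := x * b2 (- e)).
  assert (X : x = x1 * b2 e)
    by (unfold x1; rewrite Rmult_assoc, (Rmult_comm (b2 (- e))), b2_oppM; ring).
  assert (Hx1 : 0 <= x1 <= IZR (2 ^ p)).
  { rewrite <- b2_IZR by lia.
    rewrite Z.add_comm, b2_add in Hx; nra. }
  destruct (archimed (x1 - / 2)) as [U1 U2].
  set (n := up (x1 - / 2)) in *.
  assert (Hn : (0 <= n <= 2 ^ p)%Z).
  { split; [apply Z.lt_succ_r|apply Z.lt_succ_r]; apply lt_IZR;
      rewrite succ_IZR; lra. }
  assert (Hz : representable (IZR n * b2 e)).
  { destruct (Z.eq_dec n (2 ^ p)) as [->|].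
    - rewrite <- b2_IZR, <- b2_add by lia; apply representable_b2; lia.
    - exists n, e; repeat split; lia. }
  apply Rle_trans with (1 := H _ Hz).
  rewrite X, <- Rmult_minus_distr_r, Rabs_mult, (Rabs_pos_eq (b2 e)) by lra.
  unfold Zminus; rewrite b2_add, (Rmult_comm (b2 e)).
  apply Rmult_le_compat_r; [lra|].
  replace (b2 (- (1))) with (/ 2) by (simpl; field); apply Rabs_le; lra.
Qed.

Lemma exists_binade x a : b2 a <= x -> exists e, (a <= e)%Z /\ b2 e <= x < b2 (e + 1).
Proof.
  intros Ha.
  assert (H : exists n : nat, x < b2 (a + Z.of_nat n)).
  { destruct (Pow_x_infinity 2 ltac:(rewrite Rabs_pos_eq; lra) (x * b2 (- a) + 1))
      as [n Hn].
    specialize (Hn n (le_n n)); exists n.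
    rewrite Rabs_pos_eq in Hn by (apply pow_le; lra).
    rewrite b2_add, <- pow_powerRZ.
    assert (X : x = x * b2 (- a) * b2 a)
      by (rewrite Rmult_assoc, (Rmult_comm (b2 (- a))), b2_oppM; ring).
    pose proof (b2_gt0 a); nra. }
  destruct H as [n Hn]; induction n as [|n IH].
  - rewrite Z.add_0_r in Hn; lra.
  - destruct (Rlt_le_dec x (b2 (a + Z.of_nat n))) as [|Hle]; [now apply IH|].
    exists (a + Z.of_nat n)%Z; repeat split; [lia|assumption|].
    now replace (a + Z.of_nat n + 1)%Z with (a + Z.of_nat (S n))%Z by lia.
Qed.

Local Notation u := (eps F).

Lemma eps_bounds : 0 < u <= / 4.
Proof.
  rewrite eps_b2; split; [apply b2_gt0|].
  replace (/ 4) with (b2 (-2)) by (simpl; field); apply b2_le; lia.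
Qed.

Lemma near_opp K x y : near K x y -> near K (- x) (- y).
Proof. intros (d & -> & Hd); exists d; split; [ring|assumption]. Qed.

Lemma near_of_error x y :
  0 < x -> x <= y * (1 + u) -> y <= x * (1 + u) -> near (1 + u) x y.
Proof.
  intros Hx H1 H2; pose proof eps_bounds; exists (y / x); split; [field; lra|split].
  - apply Rle_div_r; [lra|]; rewrite Rmult_comm; apply Rle_div_l; lra.
  - apply Rle_div_l; lra.
Qed.

(** The bound from below is as good as the bound from above: [y] is at least the power of two
    that starts the binade of [x], so that the error is also at most [u * y]. *)
Lemma nearest_normal x y :
  nearest x y -> min_normal F <= Rabs x -> near (1 + u) x y.
Proof.
  assert (Pos : forall x y, nearest x y -> min_normal F <= x -> near (1 + u) x y).
  { clear x y; intros x y H Hx; rewrite min_normal_b2 in Hx.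
    pose proof (b2_gt0 (em + p - 1)).
    destruct (exists_binade _ _ Hx) as (e & He & Hxe).
    assert (Err : Rabs (y - x) <= b2 (e - p + 1 - 1)).
    { apply nearest_error; [assumption| |lia].
      replace (e - p + 1 + p)%Z with (e + 1)%Z by ring; lra. }
    apply Rabs_le_between in Err.
    replace (e - p + 1 - 1)%Z with (e + - p)%Z in Err by ring.
    rewrite b2_add, <- eps_b2 in Err.
    assert (b2 e <= y)
      by (apply (nearest_ge x); auto; [apply representable_b2; lia|lra]).
    pose proof eps_bounds; apply near_of_error; nra. }
  intros H Hx; destruct (Rle_dec 0 x).
  - rewrite Rabs_pos_eq in Hx by lra; auto.
  - rewrite Rabs_left in Hx by lra.
    rewrite <- (Ropp_involutive x), <- (Ropp_involutive y).
    apply near_opp, Pos; auto using nearest_opp.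
Qed.

(** A result may be rounded up to the least normal number, in which case the
    error is bounded relatively to the result only. *)
Lemma nearest_normal_result x y :
  nearest x y -> min_normal F <= Rabs y -> near (/ (1 - u)) x y.
Proof.
  pose proof eps_bounds as U.
  assert (W : 1 + u <= / (1 - u)).
  { apply Rmult_le_reg_r with (1 - u); [lra|]; rewrite Rinv_l; nra. }
  assert (Pos : forall x y, nearest x y -> 0 <= x -> min_normal F <= Rabs y ->
    near (/ (1 - u)) x y).
  { clear x y; intros x y H Hx Hy.
    assert (Hy0 : 0 <= y) by (apply (nearest_ge x); auto using representable_0).
    rewrite Rabs_pos_eq in Hy by assumption.
    destruct (Rle_dec (min_normal F) x) as [Hn|Hn].
    - apply near_weaken with (1 + u); [lra|].
      apply nearest_normal; auto; rewrite Rabs_pos_eq; lra.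
    - rewrite min_normal_b2 in *; pose proof (b2_gt0 (em + p - 1)).
      assert (y <= b2 (em + p - 1))
        by (apply (nearest_le x); auto; [apply representable_b2; lia|lra]).
      assert (Err : Rabs (y - x) <= b2 (em - 1)).
      { apply nearest_error; [assumption| |lia].
        assert (b2 (em + p - 1) <= b2 (em + p)) by (apply b2_le; lia); lra. }
      replace (em - 1)%Z with (em + p - 1 + - p)%Z in Err by ring.
      rewrite b2_add, <- eps_b2 in Err.
      apply Rabs_le_between in Err.
      assert (0 < x) by nra.
      exists (y / x); split; [field; lra|].
      rewrite Rinv_inv; split; [apply Rle_div_r; nra|].
      apply Rle_div_l; [assumption|].
      apply Rmult_le_reg_l with (1 - u); [lra|].
      rewrite <- Rmult_assoc, Rinv_r, Rmult_1_l by lra; nra. }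
  intros H Hy; destruct (Rle_dec 0 x); [auto|].
  rewrite <- (Ropp_involutive x), <- (Ropp_involutive y).
  apply near_opp, Pos; auto using nearest_opp; [lra|].
  now rewrite Rabs_Ropp.
Qed.

Lemma nearest_bound x y :
  nearest x y -> Rabs y <= (1 + u) * Rabs x + min_normal F.
Proof.
  intros H; pose proof eps_bounds.
  assert (M : 0 < min_normal F) by (rewrite min_normal_b2; apply b2_gt0).
  destruct (Rle_dec (min_normal F) (Rabs x)) as [Hn|Hn].
  - destruct (nearest_normal x y H Hn) as (d & -> & Hd).
    assert (0 < / (1 + u)) by (apply Rinv_0_lt_compat; lra).
    rewrite Rabs_mult, (Rabs_pos_eq d) by lra.
    pose proof (Rabs_pos x); nra.
  - assert (representable (min_normal F))
      by (rewrite min_normal_b2; apply representable_b2; lia).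
    apply Rnot_le_lt, Rlt_le, Rabs_le_between in Hn.
    assert (Rabs y <= min_normal F).
    { apply Rabs_le; split; [apply (nearest_ge x)|apply (nearest_le x)];
        auto using representable_opp; lra. }
    pose proof (Rabs_pos x); nra.
Qed.

(** Differences of floating-point numbers are multiples of the least subnormal number,
    hence exact in the subnormal range. *)
Lemma nearest_sum x y z :
  representable x -> representable y -> nearest (x - y) z ->
  near (1 + u) (x - y) z.
Proof.
  intros (k & j & -> & _ & Hj) (k' & j' & -> & _ & Hj') H.
  pose proof eps_bounds.
  destruct (Rle_dec (min_normal F) (Rabs (IZR k * b2 j - IZR k' * b2 j'))) as [Hn|Hn];
    [now apply nearest_normal|].
  assert (X : exists n, IZR k * b2 j - IZR k' * b2 j' = IZR n * b2 em).
  { exists (k * 2 ^ (j - em) - k' * 2 ^ (j' - em))%Z.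
    rewrite minus_IZR, !mult_IZR, <- !b2_IZR by lia.
    rewrite Rmult_minus_distr_r, !Rmult_assoc, <- !b2_add.
    do 3 f_equal; lia. }
  destruct X as [n X]; rewrite X in *.
  assert (R : representable (IZR n * b2 em)).
  { exists n, em; repeat split; [|lia].
    apply Rnot_le_lt in Hn; rewrite min_normal_b2, Rabs_mult in Hn.
    rewrite (Rabs_pos_eq (b2 em)) in Hn by apply Rlt_le, b2_gt0.
    assert (b2 (em + p - 1) < b2 p * b2 em)
      by (rewrite <- b2_add; apply b2_lt; lia).
    apply lt_IZR; rewrite abs_IZR, <- b2_IZR by lia.
    pose proof (b2_gt0 em); nra. }
  rewrite (nearest_exact _ _ H R); apply near_exact; lra.
Qed.

Lemma fp_le_nu x : fp_number F x -> Rabs (SF2R x) <= SF2R (nu F).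
Proof.
  intros Hx; rewrite nu_value by assumption.
  assert (1 <= b2 p) by (apply (b2_le 0); lia).
  pose proof (b2_gt0 (E - p)).
  destruct x as [s|s| |s m e]; try (now destruct Hx).
  - simpl; rewrite Rabs_R0; nra.
  - apply (canonical_cases F) in Hx; destruct Hx as (He & Hm & _).
    rewrite SF2R_finite.
    assert (IZR (Z.pos m) <= b2 p - 1).
    { rewrite b2_IZR, <- minus_IZR by lia; apply IZR_le.
      pose proof (digits2_pos_bounds m) as [_ U].
      assert (2 ^ Z.pos (digits2_pos m) <= 2 ^ p)%Z
        by (apply Z.pow_le_mono_r; lia); lia. }
    assert (0 <= IZR (Z.pos m)) by (apply IZR_le; lia).
    assert (b2 e <= b2 (E - p)) by (apply b2_le; lia).
    pose proof (b2_gt0 e).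
    replace (Rabs _) with (IZR (Z.pos m) * b2 e).
    + apply Rmult_le_compat; lra.
    + destruct s; rewrite ?Rabs_Ropp, Rabs_pos_eq; nra.
Qed.

(** The right-hand side is the predecessor of [2 ^ h]. *)
Lemma representable_gap z h :
  representable z -> (em + p <= h)%Z -> z < b2 h -> z <= (b2 p - 1) * b2 (h - p).
Proof.
  intros (k & j & -> & Hk & Hj) Hh Hz.
  assert (1 <= b2 p) by (apply (b2_le 0); lia).
  pose proof (b2_gt0 j); pose proof (b2_gt0 (h - p)).
  rewrite (b2_IZR p), <- minus_IZR by lia.
  destruct (Z_le_gt_dec (h - p) j) as [Hle|Hgt].
  - replace j with (j - (h - p) + (h - p))%Z in * by ring.
    rewrite b2_add, b2_IZR, <- Rmult_assoc, <- mult_IZR in * by lia.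
    replace h with (p + (h - p))%Z in Hz at 3 by ring.
    rewrite b2_add in Hz; apply Rmult_lt_reg_r in Hz; [|assumption].
    rewrite b2_IZR in Hz by lia; apply lt_IZR in Hz.
    apply Rmult_le_compat_r; [lra|]; apply IZR_le; lia.
  - assert (b2 j <= b2 (h - p)) by (apply b2_le; lia).
    assert (IZR k <= IZR (2 ^ p - 1)) by (apply IZR_le; lia).
    assert (0 <= IZR (2 ^ p - 1)) by (apply IZR_le; lia).
    nra.
Qed.

(** * Comparison, absolute value and sign *)

Lemma SF2R_pos_lt m1 e1 m2 e2 :
  fp_number F (S754_finite false m1 e1) -> fp_number F (S754_finite false m2 e2) ->
  (e1 < e2)%Z -> IZR (Z.pos m1) * b2 e1 < IZR (Z.pos m2) * b2 e2.
Proof.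
  intros H1 H2 He; apply (canonical_cases F) in H1, H2.
  apply Rlt_le_trans with (b2 (Z.pos (digits2_pos m1) + e1)).
  - apply digits2_magnitude.
  - apply Rle_trans with (b2 (Z.pos (digits2_pos m2) + e2 - 1)).
    + apply b2_le; lia.
    + apply digits2_magnitude.
Qed.

(** Exponents are compared first, which is correct on canonical numbers only: the one
    with the larger exponent is normal. *)
Lemma SFcompare_spec x y :
  fp_number F x -> fp_number F y ->
  match SFcompare x y with
  | Some Lt => SF2R x < SF2R y
  | Some Eq => SF2R x = SF2R y
  | Some Gt => SF2R y < SF2R x
  | None => False
  end.
Proof.
  intros Hx Hy.
  assert (P : forall m e, 0 < IZR (Z.pos m) * b2 e)
    by (intros; apply Rmult_lt_0_compat; [apply IZR_lt; lia|apply b2_gt0]).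
  destruct x as [sx|sx| |sx mx ex]; try (now destruct Hx);
    destruct y as [sy|sy| |sy my ey]; try (now destruct Hy).
  - destruct sy; cbn [SFcompare]; rewrite SF2R_finite; pose proof (P my ey); simpl; lra.
  - destruct sx; cbn [SFcompare]; rewrite SF2R_finite; pose proof (P mx ex); simpl; lra.
  - pose proof (P mx ex) as Px; pose proof (P my ey) as Py.
    assert (C : match match Z.compare ex ey with
        | Lt => Lt | Gt => Gt | Eq => Pos.compare_cont Eq mx my end with
      | Lt => IZR (Z.pos mx) * b2 ex < IZR (Z.pos my) * b2 ey
      | Eq => IZR (Z.pos mx) * b2 ex = IZR (Z.pos my) * b2 ey
      | Gt => IZR (Z.pos my) * b2 ey < IZR (Z.pos mx) * b2 ex
      end).
    { destruct (Z.compare_spec ex ey) as [->|He|He].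
      - pose proof (b2_gt0 ey); change (Pos.compare_cont Eq mx my) with (Pos.compare mx my).
        destruct (Pos.compare_spec mx my) as [->|Hm|Hm]; [reflexivity| |];
          apply Rmult_lt_compat_r; auto; apply IZR_lt; lia.
      - now apply SF2R_pos_lt.
      - now apply SF2R_pos_lt. }
    rewrite !SF2R_finite; destruct sx, sy; cbn [SFcompare]; try lra.
    + destruct (Z.compare ex ey); cbn [CompOpp]; try lra.
      destruct (Pos.compare_cont Eq mx my); cbn [CompOpp]; lra.
    + exact C.
Qed.

Lemma fmax_value x y :
  fp_number F x -> fp_number F y ->
  fp_number F (fmax x y) /\ SF2R (fmax x y) = Rmax (SF2R x) (SF2R y).
Proof.
  intros Hx Hy; pose proof (SFcompare_spec y x Hy Hx) as C.
  unfold fmax, SFltb; destruct (SFcompare y x) as [[| |]|]; try contradiction;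
    split; auto; [rewrite Rmax_right|rewrite Rmax_left|rewrite Rmax_right]; lra.
Qed.

Lemma fmin_value x y :
  fp_number F x -> fp_number F y ->
  fp_number F (fmin x y) /\ SF2R (fmin x y) = Rmin (SF2R x) (SF2R y).
Proof.
  intros Hx Hy; pose proof (SFcompare_spec x y Hx Hy) as C.
  unfold fmin, SFltb; destruct (SFcompare x y) as [[| |]|]; try contradiction;
    split; auto; [rewrite Rmin_right|rewrite Rmin_left|rewrite Rmin_right]; lra.
Qed.

Lemma SFabs_value x :
  fp_number F x -> fp_number F (SFabs x) /\ SF2R (SFabs x) = Rabs (SF2R x).
Proof.
  intros Hx; destruct x as [s|s| |s m e]; try (now destruct Hx).
  - simpl; rewrite Rabs_R0; auto.
  - split; [exact Hx|]; cbn [SFabs]; rewrite !SF2R_finite.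
    assert (0 <= IZR (Z.pos m) * b2 e)
      by (apply Rmult_le_pos; [apply IZR_le; lia|apply Rlt_le, b2_gt0]).
    destruct s; rewrite ?Rabs_Ropp, Rabs_pos_eq; auto.
Qed.

Lemma mul_sign_value x y :
  SF2R (mul_sign x y) = if signbit y then - SF2R x else SF2R x.
Proof. unfold mul_sign; destruct (signbit y); auto using SF2R_opp. Qed.

Lemma mul_sign_fp x y : fp_number F x -> fp_number F (mul_sign x y).
Proof. unfold mul_sign; destruct (signbit y); auto using fp_opp. Qed.

Lemma signbit_value x : fp_number F x -> SF2R x <> 0 ->
  SF2R x = if signbit x then - Rabs (SF2R x) else Rabs (SF2R x).
Proof.
  intros Hx H0; destruct x as [s|s| |s m e]; try (now destruct Hx).
  - assert (0 <= IZR (Z.pos m) * b2 e)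
      by (apply Rmult_le_pos; [apply IZR_le; lia|apply Rlt_le, b2_gt0]).
    cbn [signbit]; rewrite SF2R_finite.
    destruct s; rewrite ?Rabs_Ropp, Rabs_pos_eq; auto.
Qed.

End Accuracy.

(** * The formats of the standard *)

(** The three properties of the standard formats that the proof uses.  A range that is wide
    for the precision makes [sqrt nu] and the least normal number negligible against
    [eps]; [emax] being even, [sqrt nu] lies just below a power of two. *)
Class wide_format (F : format) : Prop := {
  wide_prec : (24 <= prec F)%Z;
  wide_emax : (5 * prec F <= emax F)%Z;
  wide_even : Z.even (emax F) = true
}.

#[export] Instance wide_format_sound F : wide_format F -> sound_format F.
Proof. intros [H1 H2 _]; split; lia. Qed.

(** For k bits, the condition on the width makes [emax] grow like [k^4 / 2^14], which exceeds
    [5 k] by far for [k >= 128]. *)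
Lemma ieee_wide F : ieee_binary F -> (23 <= sig_bits F)%Z -> wide_format F.
Proof.
  intros HF Hs; destruct F as [s w]; unfold ieee_binary, prec in *;
    cbn [sig_bits exp_bits List.In] in *.
  destruct HF as [HF|(k & Hk & _ & -> & Hw)].
  - destruct HF as [HF|[HF|[HF|[HF|[]]]]]; injection HF as <- <-; try lia;
      split; vm_compute; congruence.
  - assert (W : (15 <= w)%Z).
    { destruct (Z_lt_le_dec w 15) as [Hlt|]; [|assumption].
      assert (2 ^ (2 * w + 27) <= 2 ^ 55)%Z by (apply Z.pow_le_mono_r; lia).
      assert (128 ^ 8 <= k ^ 8)%Z by (apply Z.pow_le_mono_l; lia).
      assert (2 ^ 55 < 128 ^ 8)%Z by reflexivity.
      elim (Z.lt_irrefl (2 ^ 55)).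
      apply Z.lt_le_trans with (1 := H1), Z.le_trans with (1 := H0).
      now apply Z.le_trans with (2 := H). }
    assert (Y : (5 * k <= 2 ^ (w - 1))%Z).
    { destruct (Z_lt_le_dec (2 ^ (w - 1)) (5 * k)) as [Hlt|]; [|assumption].
      destruct Hw as [_ Hw].
      assert (P : (2 ^ (2 * w + 27) = 2 ^ (w - 1) * 2 ^ (w - 1) * 2 ^ 29)%Z)
        by (clear - W; rewrite <- !Z.pow_add_r by lia; f_equal; ring).
      rewrite P in Hw; clear P.
      assert (0 < 2 ^ (w - 1))%Z by (apply Z.pow_pos_nonneg; lia).
      assert (Hsq : (2 ^ (w - 1) * 2 ^ (w - 1) < 5 * k * (5 * k))%Z)
        by (apply Z.mul_lt_mono_nonneg; lia).
      assert (H6 : (128 ^ 6 <= k ^ 6)%Z) by (apply Z.pow_le_mono_l; lia).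
      replace (k ^ 8)%Z with (k ^ 6 * (k * k))%Z in Hw by ring.
      change (128 ^ 6)%Z with 4398046511104%Z in H6.
      change (2 ^ 29)%Z with 536870912%Z in Hw.
      revert Hw H6 Hsq; generalize (2 ^ (w - 1))%Z (k ^ 6)%Z; intros e k6 **.
      nia. }
    split; unfold prec, emax; cbn [sig_bits exp_bits]; [lia|lia|].
    replace (w - 1)%Z with (Z.succ (w - 2)) by ring.
    rewrite Z.pow_succ_r, Z.even_mul by lia; reflexivity.
Qed.

Section Constants.
Context (F : format) {WF : wide_format F}.
Local Notation p := (prec F).
Local Notation E := (emax F).
Local Notation u := (eps F).
Let Hp : (24 <= p)%Z := wide_prec.
Let HE : (5 * p <= E)%Z := wide_emax.

Lemma eps_small : 0 < u <= / 16777216.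
Proof.
  split; [apply b2_gt0|].
  replace (/ 16777216) with (b2 (-24)) by (simpl; field).
  apply b2_le; unfold prec in *; lia.
Qed.

Lemma min_normal_small : 0 < min_normal F <= u.
Proof.
  split; [apply b2_gt0|]; unfold min_normal, eps.
  apply b2_le; unfold prec in *; lia.
Qed.

Lemma nu_large : 1000 <= SF2R (nu F).
Proof.
  rewrite nu_value by apply wide_format_sound, WF.
  assert (1024 <= b2 p).
  { replace 1024 with (b2 10) by (simpl; ring); apply b2_le; lia. }
  assert (1024 <= b2 (E - p)).
  { replace 1024 with (b2 10) by (simpl; ring); apply b2_le; lia. }
  nra.
Qed.

Lemma fone_value : fp_number F (fone F) /\ SF2R (fone F) = 1.
Proof.
  pose proof (binary_round_rounds F false 1 0) as H.
  replace (SF2R _) with 1 in H by (simpl; ring).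
  pose proof nu_large.
  apply rounds_finite in H; [|rewrite Rabs_pos_eq; lra].
  destruct H as [H1 H2]; split; [exact H1|].
  apply (nearest_exact F _ _ H2), (representable_b2 F 0); unfold emin; lia.
Qed.

Lemma fzero_fp : fp_number F fzero.
Proof. repeat split. Qed.

Lemma mu_check_value : fp_number F (mu_check F) /\ 0 < SF2R (mu_check F) <= min_normal F.
Proof.
  repeat split; simpl.
  - unfold bounded, canonical_mantissa.
    rewrite (canonical_of_bounds F), Z.eqb_refl.
    + apply Z.leb_le; unfold emin; lia.
    + pose proof (Z.pow_gt_1 2 p); lia.
    + lia.
    + left; reflexivity.
  - rewrite Rmult_1_l; apply b2_gt0.
  - rewrite Rmult_1_l; apply b2_le; unfold emin; lia.
Qed.

Lemma fp_zero_inv x : fp_number F x -> SF2R x = 0 -> exists s, x = S754_zero s.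
Proof.
  intros Hx H0; destruct x as [s|s| |s m e]; try (now destruct Hx); [now exists s|].
  rewrite SF2R_finite in H0; pose proof (b2_gt0 e).
  assert (0 < IZR (Z.pos m)) by (apply IZR_lt; lia).
  destruct s; nra.
Qed.

Lemma fdiv_zero_zero x y :
  fp_number F x -> SF2R x = 0 -> fp_number F y -> SF2R y = 0 ->
  fdiv F x y = S754_nan.
Proof.
  intros Hx X0 Hy Y0; destruct (fp_zero_inv x Hx X0) as [s ->].
  destruct (fp_zero_inv y Hy Y0) as [s' ->]; reflexivity.
Qed.

Lemma nearest_0 y : nearest F 0 y -> y = 0.
Proof. intros H; exact (nearest_exact F _ _ H (representable_0 F)). Qed.

Lemma representable_2 : representable F 2.
Proof.
  replace 2 with (b2 1) by (simpl; ring).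
  apply (representable_b2 F 1); unfold emin; lia.
Qed.

Lemma representable_min_normal : representable F (min_normal F).
Proof. rewrite min_normal_b2; apply (representable_b2 F); lia. Qed.

Lemma representable_1 : representable F 1.
Proof. apply (representable_b2 F 0); unfold emin; lia. Qed.

(** * The modulus of the off-diagonal entry *)

Section Modulus.
Context (re im : spec_float) (Hre : fp_number F re) (Him : fp_number F im).
Local Notation m := (Rmin (Rabs (SF2R re)) (Rabs (SF2R im))).
Local Notation M := (Rmax (Rabs (SF2R re)) (Rabs (SF2R im))).

Lemma part_min_value : fp_number F (part_min re im) /\ SF2R (part_min re im) = m.
Proof.
  destruct (SFabs_value F re Hre) as [R1 <-], (SFabs_value F im Him) as [I1 <-].
  now apply fmin_value.
Qed.

Lemma part_max_value : fp_number F (part_max re im) /\ SF2R (part_max re im) = M.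
Proof.
  destruct (SFabs_value F re Hre) as [R1 <-], (SFabs_value F im Him) as [I1 <-].
  now apply fmax_value.
Qed.

Lemma part_order : 0 <= m <= M.
Proof.
  pose proof (Rabs_pos (SF2R re)); pose proof (Rabs_pos (SF2R im)).
  unfold Rmin, Rmax; destruct (Rle_dec _ _); lra.
Qed.

(** The formula behind the computation of the modulus: dividing by the larger part leaves a
    square root between 1 and [sqrt 2], so that no intermediate result overflows. *)
Lemma Cmod_parts : 0 < M ->
  Cmod (SF2R re, SF2R im) = M * sqrt (1 + m / M * (m / M)).
Proof.
  intros HM; pose proof part_order as O.
  transitivity (sqrt (m * m + M * M)).
  - unfold Cmod; simpl fst; simpl snd; f_equal.
    rewrite <- (pow2_abs (SF2R re)), <- (pow2_abs (SF2R im)).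
    unfold Rmin, Rmax; destruct (Rle_dec _ _); ring.
  - transitivity (sqrt (M * M) * sqrt (1 + m / M * (m / M))).
    + rewrite <- sqrt_mult_alt by nra; f_equal; field; lra.
    + now rewrite sqrt_square by lra.
Qed.

(** When both parts vanish the quotient is NaN, which [fmax] replaces by 0. *)
Lemma fl_q_value :
  fp_number F (fl_q F re im) /\ 0 <= SF2R (fl_q F re im) <= 1 /\
  (0 < M -> nearest F (m / M) (SF2R (fl_q F re im))).
Proof.
  destruct part_min_value as [m1 m2], part_max_value as [M1 M2].
  pose proof part_order as O; unfold fl_q.
  destruct (Rle_lt_or_eq_dec 0 M ltac:(lra)) as [HM|HM].
  - pose proof (fdiv_rounds F _ _ m1 M1 ltac:(rewrite M2; lra)) as D.
    rewrite m2, M2 in D.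
    assert (B : 0 <= m / M <= 1)
      by (split; [apply Rle_div_r|apply Rle_div_l]; lra).
    pose proof nu_large.
    apply rounds_finite in D; [|rewrite Rabs_pos_eq; lra].
    destruct D as [D1 D2].
    assert (0 <= SF2R (fdiv F (part_min re im) (part_max re im)) <= 1).
    { split; [apply (nearest_ge F _ _ _ D2 (representable_0 F))
             |apply (nearest_le F _ _ _ D2 representable_1)]; lra. }
    destruct (fmax_value F _ _ D1 fzero_fp) as [V1 V2].
    rewrite Rmax_left in V2 by (simpl; lra); rewrite V2; auto.
  - rewrite fdiv_zero_zero; auto; [|lra|lra].
    cbn; repeat split; lra.
Qed.

(** Since [x <= 1], the term [x * x] makes up at most half of [1 + x * x], so that the doubled
    error of the square is halved again.  A quotient that underflows may have a large
    relative error, but then both squares are at most [u * u]. *)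
Lemma near_succ_sqr x y :
  0 <= x <= 1 -> 0 <= y -> near (1 + u) x y \/ (x <= u /\ y <= u) ->
  near ((1 + u) * (1 + u * u)) (1 + x * x) (1 + y * y).
Proof.
  pose proof eps_small as U; intros Hx Hy H.
  exists ((1 + y * y) / (1 + x * x)); split; [field; nra|].
  assert (W : (1 + x * x) <= (1 + y * y) * (1 + u) /\
              1 + y * y <= (1 + x * x) * ((1 + u) * (1 + u * u))).
  { destruct H as [(d & -> & Hd)|H]; [|nra].
    assert (D1 : 1 <= d * (1 + u)).
    { apply Rmult_le_reg_l with (/ (1 + u)); [apply Rinv_0_lt_compat; lra|].
      rewrite Rmult_1_r, (Rmult_comm d), <- Rmult_assoc, Rinv_l; lra. }
    assert (X2 : 0 <= x * x <= 1) by nra.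
    assert (D0 : 0 <= d) by nra.
    split.
    - assert (1 <= d * d * ((1 + u) * (1 + u))) by nra.
      replace (d * x * (d * x)) with (d * d * (x * x)) by ring.
      set (X := x * x) in *; set (D := d * d) in *.
      assert (X <= D * ((1 + u) * (1 + u)) * X) by nra.
      assert (1 + X <= 1 + u + (1 + u) * D * X); [|nra].
      destruct (Rle_dec 1 D); nra.
    - replace (d * x * (d * x)) with (d * d * (x * x)) by ring.
      assert (d * d <= (1 + u) * (1 + u)) by nra.
      set (X := x * x) in *; set (D := d * d) in *.
      assert (D * X <= (1 + u) * (1 + u) * X) by nra.
      assert (u * X <= u) by nra.
      assert (u * u * X <= u * u) by nra.
      nra. }
  split.
  - apply Rle_div_r; [nra|].
    rewrite Rmult_comm; apply Rle_div_l; [nra|].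
    apply Rle_trans with ((1 + y * y) * (1 + u)); [apply W|].
    apply Rmult_le_compat_l; nra.
  - apply Rle_div_l; [nra|]; lra.
Qed.

(** Error factor of [fl (sqrt (1 + q^2))], the final product excluded. *)
Definition Kmod : R := (1 + u) * (1 + u) * (1 + u * u).

Lemma fl_sqrt_1q2_value :
  fp_number F (fl_sqrt_1q2 F re im) /\ 1 <= SF2R (fl_sqrt_1q2 F re im) <= 2 /\
  (0 < M -> near Kmod (sqrt (1 + m / M * (m / M))) (SF2R (fl_sqrt_1q2 F re im))).
Proof.
  pose proof eps_small as U; pose proof min_normal_small as N; pose proof nu_large.
  destruct fl_q_value as (q1 & q2 & q3); unfold fl_sqrt_1q2.
  set (q := fl_q F re im) in *; destruct fone_value as [o1 o2].
  pose proof (fma_rounds F q q (fone F) q1 q1 o1) as R; rewrite o2 in R.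
  apply rounds_finite in R; [|rewrite Rabs_pos_eq; nra].
  destruct R as [f1 f2]; set (f := fma F q q (fone F)) in *.
  assert (f3 : 1 <= SF2R f <= 2).
  { split; [apply (nearest_ge F _ _ _ f2 representable_1)
           |apply (nearest_le F _ _ _ f2 representable_2)]; nra. }
  assert (s3 : 1 <= sqrt (SF2R f) <= 2).
  { split; [rewrite <- sqrt_1; apply sqrt_le_1_alt; lra|].
    rewrite <- (sqrt_square 2) by lra; apply sqrt_le_1_alt; lra. }
  pose proof (fsqrt_rounds F f f1 ltac:(lra)) as R.
  apply rounds_finite in R; [|rewrite Rabs_pos_eq; lra].
  destruct R as [s1 s2]; split; [exact s1|split].
  - split; [apply (nearest_ge F _ _ _ s2 representable_1)
           |apply (nearest_le F _ _ _ s2 representable_2)]; lra.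
  - intros HM; specialize (q3 HM); pose proof part_order as O.
    assert (B : 0 <= m / M <= 1)
      by (split; [apply Rle_div_r|apply Rle_div_l]; lra).
    unfold Kmod; apply near_weaken with ((1 + u) * (1 + u * u) * (1 + u)); [nra|].
    apply near_trans with (sqrt (SF2R f)); [nra|lra| |].
    + apply near_sqrt; [nra|nra|].
      apply near_weaken with ((1 + u) * (1 + u * u) * (1 + u)).
      { split; [nra|]; apply Rmult_le_compat_l; nra. }
      apply near_trans with (1 + SF2R q * SF2R q); [nra|lra| |].
      * apply near_succ_sqr; [assumption|lra|].
        destruct (Rle_dec (min_normal F) (m / M)) as [Hn|Hn]; [left|right].
        -- apply (nearest_normal F); [exact q3|rewrite Rabs_pos_eq; lra].
        -- split; [lra|]; apply Rle_trans with (min_normal F); [|lra].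
           apply (nearest_le F _ _ _ q3); [apply representable_min_normal|lra].
      * rewrite (Rplus_comm 1 (SF2R q * _)); apply (nearest_normal F); [exact f2|].
        rewrite Rabs_pos_eq; nra.
    + apply (nearest_normal F); [exact s2|rewrite Rabs_pos_eq; lra].
Qed.

(** The lower bound by the larger part, which is representable, is what keeps the computed
    cosine and sine of the argument at most 1 in magnitude. *)
Lemma fl_abs_complex_value (h := fl_abs F (ComplexScalar re im))
    (A := Cmod (SF2R re, SF2R im)) :
  A <= SF2R (nu F) / 5 ->
  fp_number F h /\ M <= SF2R h <= (1 + 5 * u) * A + min_normal F /\
  (M = 0 -> SF2R h = 0) /\
  (0 < M ->
    ~ underflows F (SF2R (part_max re im) * SF2R (fl_sqrt_1q2 F re im)) h ->
    min_normal F <= SF2R h /\ near (Kmod * / (1 - u)) A (SF2R h)).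
Proof.
  intros HA; unfold h, fl_abs; fold h in HA |- *.
  pose proof eps_small as U; pose proof min_normal_small as N; pose proof nu_large.
  destruct part_max_value as [M1 M2].
  destruct fl_sqrt_1q2_value as (s1 & s2 & s3).
  pose proof part_order as O.
  assert (A0 : 0 <= A) by apply Cmod_ge_0.
  assert (AM : M <= A) by apply (Rmax_Cmod (SF2R re, SF2R im)).
  pose proof (fmul_rounds F _ _ M1 s1) as R; rewrite M2 in R.
  set (S := SF2R (fl_sqrt_1q2 F re im)) in *.
  apply rounds_finite in R; [|rewrite Rabs_pos_eq; nra].
  destruct R as [h1 h2]; split; [exact h1|].
  assert (MH : M <= SF2R (fmul F (part_max re im) (fl_sqrt_1q2 F re im))).
  { apply (nearest_ge F _ _ _ h2); [|nra].
    rewrite <- M2; now apply (fp_representable F). }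
  assert (MS : 0 < M -> near Kmod A (M * S)).
  { intros HM; unfold A; rewrite Cmod_parts by assumption.
    rewrite <- (Rmult_1_l Kmod); apply near_mul; [lra|unfold Kmod; nra| |auto].
    apply near_exact; lra. }
  split; [|split].
  - split; [exact MH|].
    apply Rle_trans with (1 := Rle_abs _).
    apply Rle_trans with (1 := nearest_bound F _ _ h2).
    apply Rplus_le_compat_r.
    destruct (Rle_lt_or_eq_dec 0 M ltac:(lra)) as [HM|HM].
    + destruct (MS HM) as (d & -> & Hd).
      assert (0 < / Kmod) by (apply Rinv_0_lt_compat; unfold Kmod; nra).
      rewrite Rabs_pos_eq by nra.
      assert ((1 + u) * d <= 1 + 5 * u).
      { apply Rle_trans with ((1 + u) * Kmod); [nra|unfold Kmod; nra]. }
      nra.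
    + rewrite <- HM, Rmult_0_l, Rabs_R0; nra.
  - intros M0; apply nearest_0; now rewrite M0, Rmult_0_l in h2.
  - intros HM Hu.
    assert (HN : min_normal F <= SF2R (fmul F (part_max re im) (fl_sqrt_1q2 F re im))).
    { apply Rnot_lt_le; intros Hlt; apply Hu; split; [fold S; rewrite M2; nra|].
      unfold h, fl_abs; rewrite Rabs_pos_eq; lra. }
    split; [exact HN|].
    apply near_trans with (M * S); [unfold Kmod; nra| |auto|].
    + apply Rinv_0_lt_compat; lra.
    + apply (nearest_normal_result F); [exact h2|].
      rewrite Rabs_pos_eq; lra.
Qed.

End Modulus.
End Constants.

(** * The argument of the off-diagonal entry *)

Section Argument.
Context (F : format) {WF : wide_format F}.
Local Notation u := (eps F).

(** Error factor of the computed modulus; it is exact in the real case. *)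
Definition Kabs (z : scalar) : R :=
  match z with
  | RealScalar _ => 1
  | ComplexScalar _ _ => Kmod F * / (1 - u)
  end.

(** Error factor of the computed cosine and sine of the argument. *)
Definition Karg : R := Kmod F * / (1 - u) * / (1 - u).

(** The part of [no_underflow] that speaks of the off-diagonal entry. *)
Definition no_underflow_polar (z : scalar) : Prop :=
  match z with
  | RealScalar _ => True
  | ComplexScalar re im =>
      ~ underflows F (SF2R (part_max re im) * SF2R (fl_sqrt_1q2 F re im))
          (fl_abs F z) /\
      ~ underflows F (SF2R re / SF2R (fl_abs F z)) (fl_cos_arg F z) /\
      ~ underflows F (SF2R im / SF2R (fmax (fl_abs F z) (mu_check F)))
          (fl_sin_arg F z)
  end.

Lemma Kmod_pos : 1 <= Kmod F.
Proof. pose proof (eps_small F); unfold Kmod; nra. Qed.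

Lemma inv_1_minus_eps : 1 <= / (1 - u).
Proof.
  pose proof (eps_small F); rewrite <- Rinv_1; apply Rinv_le_contravar; lra.
Qed.

Lemma Cmod_real x : Cmod (x, 0) = Rabs x.
Proof. apply (Cmod_R x). Qed.

Lemma Cmod_pos_max a b : 0 < Cmod (a, b) -> 0 < Rmax (Rabs a) (Rabs b).
Proof.
  intros H; pose proof (Cmod_2Rmax (a, b)) as C; simpl in C.
  pose proof Rlt_sqrt2_0; nra.
Qed.

Lemma fl_abs_value z (A := Cmod (scalar_C z)) :
  scalar_fp F z -> A <= SF2R (nu F) / 5 ->
  fp_number F (fl_abs F z) /\
  0 <= SF2R (fl_abs F z) <= (1 + 5 * u) * A + min_normal F /\
  (A = 0 -> SF2R (fl_abs F z) = 0) /\ (0 < A -> 0 < SF2R (fl_abs F z)).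
Proof.
  pose proof (eps_small F) as U; pose proof (min_normal_small F) as N.
  assert (A0 : 0 <= A) by apply Cmod_ge_0.
  destruct z as [x|re im]; simpl scalar_fp; intros Hz HA.
  - destruct (SFabs_value F x Hz) as [x1 x2].
    assert (E : A = Rabs (SF2R x)) by apply Cmod_real.
    simpl fl_abs; rewrite x2, <- E.
    split; [exact x1|split; [split; nra|auto]].
  - destruct Hz as [Hre Him].
    destruct (fl_abs_complex_value F re im Hre Him HA) as (h1 & h2 & h3 & _).
    pose proof (part_order re im) as O.
    assert (AM : Rmax (Rabs (SF2R re)) (Rabs (SF2R im)) <= A)
      by apply (Rmax_Cmod (SF2R re, SF2R im)).
    split; [exact h1|split; [split; [lra|exact (proj2 h2)]|split]].
    + intros HA0; apply h3; lra.
    + intros HA0; apply Cmod_pos_max in HA0; lra.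
Qed.

Lemma fl_abs_accurate z :
  scalar_fp F z -> Cmod (scalar_C z) <= SF2R (nu F) / 5 ->
  no_underflow_polar z ->
  near (Kabs z) (Cmod (scalar_C z)) (SF2R (fl_abs F z)).
Proof.
  intros Hz HA Hu; destruct z as [x|re im].
  - destruct (SFabs_value F x Hz) as [_ x2].
    simpl; rewrite x2, Cmod_real; apply near_exact; lra.
  - destruct Hz as [Hre Him], Hu as [Hu _].
    destruct (fl_abs_complex_value F re im Hre Him HA) as (_ & h2 & h3 & h4).
    destruct (Rle_lt_or_eq_dec 0 _ (Cmod_ge_0 (scalar_C (ComplexScalar re im))))
      as [A0|A0].
    + apply h4; [now apply Cmod_pos_max|exact Hu].
    + rewrite <- A0, h3.
      * apply near_exact; simpl; pose proof Kmod_pos; pose proof inv_1_minus_eps; nra.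
      * pose proof (part_order re im).
        pose proof (Rmax_Cmod (SF2R re, SF2R im)); simpl in *; lra.
Qed.

Lemma quotient_le_1 x y :
  fp_number F x -> fp_number F y -> Rabs (SF2R x) <= SF2R y -> 0 < SF2R y ->
  fp_number F (fdiv F x y) /\
  nearest F (SF2R x / SF2R y) (SF2R (fdiv F x y)) /\
  -1 <= SF2R (fdiv F x y) <= 1.
Proof.
  intros Hx Hy Hxy Hy0; pose proof (nu_large F).
  pose proof (fdiv_rounds F x y Hx Hy ltac:(lra)) as R.
  apply Rabs_le_between in Hxy.
  assert (B : -1 <= SF2R x / SF2R y <= 1)
    by (split; [apply Rle_div_r|apply Rle_div_l]; lra).
  apply rounds_finite in R; [|apply Rabs_le; lra].
  destruct R as [R1 R2]; repeat split; try apply R1; try apply R2.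
  - apply (nearest_ge F _ _ _ R2); [|lra].
    replace (-1) with (- (1)) by ring.
    apply (representable_opp F), (representable_1 F).
  - apply (nearest_le F _ _ _ R2 (representable_1 F)); lra.
Qed.

(** The divisor stays positive for [a21 = 0], and is left alone whenever the modulus is
    normal. *)
Lemma mu_check_max x :
  fp_number F x -> fp_number F (fmax x (mu_check F)) /\
  SF2R x <= SF2R (fmax x (mu_check F)) /\ 0 < SF2R (fmax x (mu_check F)) /\
  (min_normal F <= SF2R x -> SF2R (fmax x (mu_check F)) = SF2R x).
Proof.
  intros Hx; destruct (mu_check_value F) as [m1 m2].
  destruct (fmax_value F _ _ Hx m1) as [V1 V2]; rewrite V2.
  pose proof (Rmax_l (SF2R x) (SF2R (mu_check F))).
  pose proof (Rmax_r (SF2R x) (SF2R (mu_check F))).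
  split; [exact V1|split; [lra|split; [lra|intros; apply Rmax_left; lra]]].
Qed.

(** The quotient is at most 1 whenever it is a number, so [fmin] changes only the NaN that
    comes from [0 / 0]. *)
Lemma fl_cos_complex re im (h := fl_abs F (ComplexScalar re im)) :
  fp_number F re -> fp_number F im ->
  Cmod (SF2R re, SF2R im) <= SF2R (nu F) / 5 ->
  fp_number F (fmin (fdiv F (SFabs re) h) (fone F)) /\
  (0 < SF2R h -> nearest F (Rabs (SF2R re) / SF2R h)
     (SF2R (fmin (fdiv F (SFabs re) h) (fone F)))) /\
  (SF2R h = 0 -> SF2R (fmin (fdiv F (SFabs re) h) (fone F)) = 1).
Proof.
  intros Hre Him HA.
  destruct (fl_abs_complex_value F re im Hre Him HA) as (h1 & h2 & _).
  fold h in h1, h2; pose proof (part_order re im) as O.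
  pose proof (Rmax_l (Rabs (SF2R re)) (Rabs (SF2R im))) as Mr.
  destruct (SFabs_value F re Hre) as [r1 r2], (fone_value F) as [o1 o2].
  destruct (Rle_lt_or_eq_dec 0 (SF2R h) ltac:(lra)) as [Hh|Hh].
  - destruct (quotient_le_1 (SFabs re) h r1 h1) as (q1 & q2 & q3);
      [rewrite r2, Rabs_Rabsolu; lra|exact Hh|].
    rewrite r2 in q2.
    destruct (fmin_value F _ _ q1 o1) as [V1 V2].
    rewrite o2, Rmin_left in V2 by lra.
    rewrite V2; split; [exact V1|split; [intros _; exact q2|intros; lra]].
  - rewrite fdiv_zero_zero with (F := F); auto.
    + split; [exact o1|split; [intros; lra|intros; exact o2]].
    + rewrite r2; pose proof (Rabs_pos (SF2R re)); lra.
Qed.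

Lemma fl_cos_sin_fp z :
  scalar_fp F z -> Cmod (scalar_C z) <= SF2R (nu F) / 5 ->
  fp_number F (fl_cos_arg F z) /\ fp_number F (fl_sin_arg F z).
Proof.
  intros Hz HA; destruct z as [x|re im].
  - split; [apply mul_sign_fp, fone_value, WF|apply fzero_fp].
  - destruct Hz as [Hre Him].
    split; [now apply mul_sign_fp, fl_cos_complex|].
    destruct (fl_abs_complex_value F re im Hre Him HA) as (h1 & h2 & _).
    destruct (mu_check_max _ h1) as (m1 & m2 & m3 & _).
    pose proof (Rmax_r (Rabs (SF2R re)) (Rabs (SF2R im))).
    apply quotient_le_1; auto; lra.
Qed.

(** A vanishing [a21] has argument 0; its computed cosine is [1] times the sign of the real
    part, whence the hypothesis on the sign bit. *)
Lemma fl_cos_sin_accurate z alpha :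
  scalar_fp F z -> Cmod (scalar_C z) <= SF2R (nu F) / 5 ->
  is_arg (scalar_C z) alpha ->
  (scalar_C z = RtoC 0 -> signbit (real_part z) = false) ->
  no_underflow_polar z ->
  near Karg (cos alpha) (SF2R (fl_cos_arg F z)) /\
  near Karg (sin alpha) (SF2R (fl_sin_arg F z)).
Proof.
  intros Hz HA (_ & Harg & Harg0) Hs Hu.
  assert (K1 : 1 <= Karg)
    by (unfold Karg; pose proof Kmod_pos; pose proof inv_1_minus_eps; nra).
  destruct (fone_value F) as [o1 o2].
  destruct (Rle_lt_or_eq_dec 0 _ (Cmod_ge_0 (scalar_C z))) as [A0|A0].
  - destruct z as [x|re im].
    + simpl scalar_C in *; rewrite Cmod_real in *.
      injection Harg as Hc Hsn.
      assert (SF2R x <> 0) by (intros X; rewrite X, Rabs_R0 in A0; lra).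
      pose proof (signbit_value F x Hz H) as Sx.
      simpl fl_cos_arg; simpl fl_sin_arg; rewrite mul_sign_value, o2.
      replace (sin alpha) with 0 by nra.
      replace (cos alpha) with (if signbit x then - (1) else 1)
        by (destruct (signbit x); nra).
      split; apply near_exact, K1.
    + destruct Hz as [Hre Him], Hu as (Hu1 & Hu2 & Hu3).
      destruct (fl_abs_complex_value F re im Hre Him HA) as (h1 & h2 & _ & h4).
      destruct (h4 (Cmod_pos_max _ _ A0) Hu1) as [h5 h6]; clear h4.
      destruct (mu_check_max _ h1) as (m1 & m2 & m3 & m4); specialize (m4 h5).
      pose proof (min_normal_small F) as N.
      destruct (fl_cos_complex re im Hre Him HA) as (c1 & c2 & _).
      specialize (c2 ltac:(lra)).
      pose proof (Rmax_r (Rabs (SF2R re)) (Rabs (SF2R im))) as Mi.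
      destruct (quotient_le_1 im _ Him m1) as (s1 & s2 & _); [lra|exact m3|].
      simpl scalar_C in *; injection Harg as Hc Hsn.
      set (A := Cmod (SF2R re, SF2R im)) in *.
      set (h := fl_abs F (ComplexScalar re im)) in *.
      assert (Q : forall v w y, v = A * w -> nearest F (v / SF2R h) y ->
        (v <> 0 -> min_normal F <= Rabs y) -> near Karg w y).
      { intros v w y Hv Hn Hy; destruct (Req_dec v 0) as [V0|V0].
        - rewrite V0 in Hn; unfold Rdiv in Hn; rewrite Rmult_0_l in Hn.
          rewrite (nearest_0 F _ Hn); replace w with 0 by nra.
          now apply near_exact.
        - pose proof Kmod_pos; pose proof inv_1_minus_eps.
          apply near_trans with (v / SF2R h); [nra|lra| |].
          + replace w with (v / A) by (rewrite Hv; field; lra).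
            rewrite <- (Rmult_1_l (Kmod F * _)).
            apply near_div; [lra|nra|apply near_exact; lra|exact h6].
          + apply (nearest_normal_result F); auto. }
      assert (NU : forall v y, v <> 0 -> ~ underflows F (v / SF2R h) y ->
        min_normal F <= Rabs (SF2R y)).
      { intros v y V0 Hu; apply Rnot_lt_le; intros Hlt; apply Hu; split; [|exact Hlt].
        apply Rmult_integral_contrapositive; split; [exact V0|].
        apply Rinv_neq_0_compat; lra. }
      split.
      * apply Q with (1 := Hc); [|intros; eapply NU; eauto].
        change (fl_cos_arg F _) with (mul_sign (fmin (fdiv F (SFabs re) h) (fone F)) re).
        rewrite mul_sign_value.
        destruct (Req_dec (SF2R re) 0) as [R0|R0].
        -- rewrite R0, Rabs_R0 in c2; rewrite R0.
           unfold Rdiv in *; rewrite Rmult_0_l in *.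
           rewrite (nearest_0 F _ c2), Ropp_0.
           destruct (signbit re); apply (nearest_refl_0 F).
        -- rewrite (signbit_value F re Hre R0).
           destruct (signbit re); [|exact c2].
           unfold Rdiv; rewrite Ropp_mult_distr_l_reverse.
           now apply (nearest_opp F).
      * apply Q with (1 := Hsn).
        -- change (fl_sin_arg F _) with (fdiv F im (fmax h (mu_check F))).
           now rewrite m4 in s2 at 1.
        -- intros V0; rewrite m4 in Hu3; eapply NU; eauto.
  - symmetry in A0; apply Cmod_eq_0 in A0.
    rewrite (Harg0 A0), cos_0, sin_0; specialize (Hs A0).
    destruct z as [x|re im].
    + simpl fl_cos_arg; simpl fl_sin_arg; simpl in Hs.
      rewrite mul_sign_value, Hs, o2; split; apply near_exact, K1.
    + destruct Hz as [Hre Him].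
      destruct (fl_abs_complex_value F re im Hre Him HA) as (h1 & h2 & h3 & _).
      simpl in A0; injection A0 as R0 I0.
      rewrite R0, I0, Rabs_R0, Rmax_left in h3 by lra; specialize (h3 eq_refl).
      destruct (fl_cos_complex re im Hre Him HA) as (_ & _ & c3).
      destruct (mu_check_max _ h1) as (m1 & m2 & m3 & _).
      destruct (quotient_le_1 im _ Him m1) as (_ & s2 & _);
        [rewrite I0, Rabs_R0; lra|exact m3|].
      set (h := fl_abs F (ComplexScalar re im)) in *.
      change (fl_cos_arg F _) with (mul_sign (fmin (fdiv F (SFabs re) h) (fone F)) re).
      change (fl_sin_arg F _) with (fdiv F im (fmax h (mu_check F))).
      simpl in Hs; rewrite mul_sign_value, Hs, (c3 h3).
      unfold Rdiv in s2; rewrite I0, Rmult_0_l in s2.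
      rewrite (nearest_0 F _ s2).
      split; apply near_exact, K1.
Qed.

(** The square of the modulus is a mean of the squares of the two error factors, weighted by
    [cos^2] and [sin^2]. *)
Lemma Cmod_near K a x y :
  0 < K -> near K (cos a) x -> near K (sin a) y -> / K <= Cmod (x, y) <= K.
Proof.
  intros HK (d & -> & Hd) (e & -> & He).
  assert (0 < / K) by now apply Rinv_0_lt_compat.
  pose proof (sin2_cos2 a) as T; unfold Rsqr in T.
  unfold Cmod; simpl fst; simpl snd.
  assert (Q : / K * / K <= (d * cos a) ^ 2 + (e * sin a) ^ 2 <= K * K).
  { replace ((d * cos a) ^ 2 + (e * sin a) ^ 2)
      with (d * d * (cos a * cos a) + e * e * (sin a * sin a)) by ring.
    assert (/ K * / K <= d * d <= K * K) by (split; nra).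
    assert (/ K * / K <= e * e <= K * K) by (split; nra).
    pose proof (Rle_0_sqr (cos a)); pose proof (Rle_0_sqr (sin a)).
    unfold Rsqr in *; split; nra. }
  split.
  - rewrite <- (sqrt_square (/ K)) by lra; apply sqrt_le_1_alt; lra.
  - rewrite <- (sqrt_square K) by lra; apply sqrt_le_1_alt; lra.
Qed.

End Argument.

(** * The tangent of the half angle as a function of the tangent *)

(** The tangent of [phi] when [x = tan (2 phi)] and [|phi| < PI / 4]. *)
Definition half_tan (x : R) : R := x / (1 + sqrt (1 + x * x)).

Lemma sqrt_1_sqr_ge x : 1 <= sqrt (1 + x * x) /\ Rabs x <= sqrt (1 + x * x).
Proof.
  split.
  - rewrite <- sqrt_1 at 1; apply sqrt_le_1_alt; nra.
  - rewrite <- sqrt_Rsqr_abs; apply sqrt_le_1_alt; unfold Rsqr; lra.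
Qed.

Lemma half_tan_opp x : half_tan (- x) = - half_tan x.
Proof.
  unfold half_tan; replace (- x * - x) with (x * x) by ring.
  unfold Rdiv; ring.
Qed.

Lemma half_tan_0 : half_tan 0 = 0.
Proof. unfold half_tan, Rdiv; ring. Qed.

Lemma half_tan_pos x : 0 < x -> 0 < half_tan x.
Proof.
  intros Hx; pose proof (sqrt_1_sqr_ge x); apply Rdiv_lt_0_compat; lra.
Qed.

Lemma half_tan_bounds x : 0 < x -> / (1 + 2 / x) <= half_tan x <= 1.
Proof.
  intros Hx; destruct (sqrt_1_sqr_ge x) as [S1 S2].
  rewrite Rabs_pos_eq in S2 by lra.
  assert (S3 : sqrt (1 + x * x) <= 1 + x).
  { rewrite <- (sqrt_square (1 + x)) by lra; apply sqrt_le_1_alt; nra. }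
  unfold half_tan; split.
  - replace (/ (1 + 2 / x)) with (x / (2 + x)) by (field; lra).
    apply Rmult_le_compat_l; [lra|]; apply Rinv_le_contravar; lra.
  - apply Rle_div_l; lra.
Qed.

(** The function is increasing, but grows more slowly than [x]: scaling [x] by [d] scales
    its value by a factor between 1 and [d]. *)
Lemma near_half_tan K x y :
  1 <= K -> 0 <= x -> near K x y -> near K (half_tan x) (half_tan y).
Proof.
  intros HK Hx (d & -> & Hd); unfold half_tan.
  assert (K0 : 0 < / K) by (apply Rinv_0_lt_compat; lra).
  assert (K1 : / K <= 1) by (rewrite <- Rinv_1; apply Rinv_le_contravar; lra).
  set (S := sqrt (1 + x * x)); set (T := sqrt (1 + d * x * (d * x))).
  assert (HS : 1 <= S) by apply sqrt_1_sqr_ge.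
  assert (HT : 1 <= T) by apply sqrt_1_sqr_ge.
  assert (SS : S * S = 1 + x * x) by (apply sqrt_sqrt; nra).
  assert (TT : T * T = 1 + d * x * (d * x)) by (apply sqrt_sqrt; nra).
  assert (X2 : 0 <= x * x) by nra.
  exists (d * (1 + S) / (1 + T)); split; [field; lra|].
  assert (D : 0 < d) by lra.
  destruct (Rle_dec 1 d) as [D1|D1].
  - assert (1 <= d * d) by nra.
    assert (S <= T).
    { apply sqrt_le_1_alt; nra. }
    assert (T <= d * S).
    { unfold T; rewrite <- (sqrt_square (d * S)) by nra.
      apply sqrt_le_1_alt; nra. }
    split; [apply Rle_div_r; nra|apply Rle_div_l; nra].
  - assert (d * d <= 1) by nra.
    assert (T <= S).
    { apply sqrt_le_1_alt; nra. }
    assert (d * S <= T).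
    { unfold T; rewrite <- (sqrt_square (d * S)) by nra.
      apply sqrt_le_1_alt; nra. }
    split; [apply Rle_div_r; nra|apply Rle_div_l; nra].
Qed.

Lemma near_of_interval L x y :
  0 < L -> / L <= x <= 1 -> / L <= y <= 1 -> near L x y.
Proof.
  intros HL Hx Hy; assert (0 < / L) by now apply Rinv_0_lt_compat.
  assert (E : / L * L = 1) by (field; lra).
  exists (y / x); split; [field; lra|split].
  - apply Rle_div_r; nra.
  - apply Rle_div_l; nra.
Qed.

Lemma tan_half_tan phi :
  - PI / 4 <= phi <= PI / 4 -> cos (2 * phi) <> 0 ->
  tan phi = half_tan (tan (2 * phi)).
Proof.
  intros Hphi Hc.
  pose proof PI_RGT_0.
  assert (C1 : 0 < cos phi) by (apply cos_gt_0; lra).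
  assert (C2 : 0 < cos (2 * phi)).
  { assert (0 <= cos (2 * phi)) by (apply cos_ge_0; lra); lra. }
  pose proof (sin2_cos2 (2 * phi)) as P; unfold Rsqr in P.
  unfold half_tan.
  replace (sqrt _) with (/ cos (2 * phi)).
  - unfold tan; rewrite sin_2a.
    assert (E : cos (2 * phi) = 2 * (cos phi * cos phi) - 1)
      by (rewrite cos_2a_cos; ring).
    set (c := cos (2 * phi)) in *.
    replace (2 * sin phi * cos phi / c / (1 + / c))
      with (2 * sin phi * cos phi / (1 + c)) by (field; lra).
    rewrite E; field; nra.
  - symmetry; rewrite <- (sqrt_square (/ cos (2 * phi)))
      by (left; now apply Rinv_0_lt_compat).
    f_equal; unfold tan.
    apply Rmult_eq_reg_r with (cos (2 * phi) * cos (2 * phi)); [|nra].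
    field_simplify; [|lra|lra]. nra.
Qed.

Lemma cos_of_tan phi :
  0 < cos phi -> cos phi = / sqrt (1 + tan phi * tan phi).
Proof.
  intros C; rewrite <- (Rinv_inv (cos phi)) at 1; f_equal.
  rewrite <- (sqrt_square (/ cos phi)) by (left; now apply Rinv_0_lt_compat).
  f_equal; unfold tan; pose proof (sin2_cos2 phi) as P; unfold Rsqr in P.
  apply Rmult_eq_reg_r with (cos phi * cos phi); [|nra].
  field_simplify; [|lra|lra]. nra.
Qed.

(** * The computed tangents *)

Section Tangents.
Context (F : format) {WF : wide_format F}.
Local Notation p := (prec F).
Local Notation E := (emax F).
Local Notation u := (eps F).
Local Notation nuR := (SF2R (nu F)).
Let Hp : (24 <= p)%Z := wide_prec.
Let HE : (5 * p <= E)%Z := wide_emax.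

Local Notation cap := (fsqrt F (nu F)).
Local Notation Omega := (SF2R cap).

(** With [P = 2 ^ prec], [sqrt nu] is a power of two times [sqrt (P (P - 1))], and this root is
    below [P - 1/2]; so it is rounded down to [P - 1] and not up to [P], whose square would
    overflow. *)
Lemma cap_value :
  fp_number F cap /\ 16 / u <= Omega /\ Omega * Omega + 1 <= nuR.
Proof.
  pose proof (nu_large F) as NL; pose proof (nu_fp F) as NF.
  pose proof (nu_value F) as NV.
  set (h := Z.div2 E).
  assert (Eh : E = (h + h)%Z).
  { unfold h; pose proof (Zdiv2_odd_eqn E) as D.
    rewrite <- Z.negb_even, wide_even in D; cbn [negb] in D; lia. }
  assert (P24 : 16777216 <= b2 p).
  { replace 16777216 with (b2 24) by (simpl; ring); apply b2_le; lia. }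
  set (P := b2 p) in *.
  assert (V2 : nuR = (P - 1) * P * (b2 (h - p) * b2 (h - p))).
  { rewrite NV, <- b2_add;
    replace (E - p)%Z with (p + (h - p + (h - p)))%Z by lia.
    rewrite b2_add; fold P; ring. }
  pose proof (b2_gt0 (h - p)) as G.
  set (g := b2 (h - p)) in *.
  assert (Hg : b2 h = P * g).
  { unfold P, g; rewrite <- b2_add; f_equal; ring. }
  assert (G1 : 1 <= g) by (apply (b2_le 0); lia).
  assert (SV : sqrt nuR * sqrt nuR = (P - 1) * P * (g * g))
    by (rewrite sqrt_sqrt; lra).
  pose proof (sqrt_pos nuR) as S0.
  set (s := sqrt nuR) in *.
  assert (SL : (P - 1) * g <= s).
  { apply Rsqr_incr_0_var; [unfold Rsqr|assumption].
    rewrite SV; assert (0 <= (P - 1) * (g * g)) by nra; nra. }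
  (* [sqrt nu] lies strictly below the middle of [P g] and its predecessor *)
  assert (SU : s < (P - / 2) * g).
  { apply Rsqr_incrst_0; [unfold Rsqr|lra|nra].
    rewrite SV; assert (0 < g * g) by nra; nra. }
  assert (R1 : representable F ((P - 1) * g)).
  { exists (2 ^ p - 1)%Z, (h - p)%Z; split; [|split].
    - rewrite minus_IZR, <- b2_IZR by lia; reflexivity.
    - pose proof (Z.pow_pos_nonneg 2 p); lia.
    - unfold emin; lia. }
  pose proof (fsqrt_rounds F (nu F) NF ltac:(lra)) as R.
  apply rounds_finite in R.
  2:{ fold s; rewrite Rabs_pos_eq by assumption.
      assert (1 <= s) by nra; nra. }
  destruct R as [w1 w2]; fold s in w2; split; [exact w1|].
  assert (WL : (P - 1) * g <= Omega) by (apply (nearest_ge F _ _ _ w2); auto).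
  assert (WU : Omega <= (P - 1) * g).
  { apply (representable_gap F); [now apply (fp_representable F)|unfold emin; lia|].
    destruct w2 as [_ w2]; apply w2 in R1.
    rewrite Hg; apply Rabs_le_between in R1.
    rewrite (Rabs_left1 (_ - s)) in R1 by lra; lra. }
  split.
  - assert (U : / u = P) by (unfold P; rewrite eps_b2, powerRZ_neg', Rinv_inv; reflexivity).
    unfold Rdiv; rewrite U.
    assert (32 <= g).
    { replace 32 with (b2 5) by (simpl; ring); apply b2_le; lia. }
    nra.
  - rewrite V2.
    assert (Omega * Omega <= (P - 1) * g * ((P - 1) * g)).
    { apply Rmult_le_compat; nra. }
    assert (1 <= (P - 1) * (g * g)) by nra.
    nra.
Qed.

(** The magnitude of [fl (tan (2 phi))], before the sign is transferred. *)
Definition clamped_quotient (o a : spec_float) : spec_float :=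
  fmin (fmax (fdiv F o (SFabs a)) fzero) cap.

(** The cap is taken when the exact quotient is infinite or when it is at least about as large
    as the cap, whether or not its computation overflows.  The cruder factor 2 is
    enough, since so large a quotient need not be known accurately. *)
Lemma clamped_quotient_value o a (r := SF2R (clamped_quotient o a)) :
  fp_number F o -> fp_number F a -> 0 <= SF2R o ->
  fp_number F (clamped_quotient o a) /\ 0 <= r <= Omega /\
  (SF2R o = 0 -> r = 0) /\
  (0 < SF2R o ->
    (r = Omega /\ (SF2R a = 0 \/ Omega <= 2 * (SF2R o / Rabs (SF2R a)))) \/
    (SF2R a <> 0 /\ nearest F (SF2R o / Rabs (SF2R a)) r)).
Proof.
  intros Ho Ha Ho0; destruct cap_value as (w1 & w2 & w3).
  pose proof (eps_small F) as U.
  assert (W0 : 0 < Omega).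
  { assert (0 < 16 / u) by (apply Rdiv_lt_0_compat; lra); lra. }
  destruct (SFabs_value F a Ha) as [a1 a2].
  pose proof (fzero_fp F) as z1.
  (* common to zero and positive quotients, as long as they are finite *)
  assert (Fin : forall x, fp_number F (fdiv F o (SFabs a)) -> 0 <= x ->
    nearest F x (SF2R (fdiv F o (SFabs a))) ->
    fp_number F (clamped_quotient o a) /\ 0 <= r <= Omega /\
    ((r = Omega /\ Omega <= 2 * x) \/ nearest F x r)).
  { intros x q1 X0 q2; unfold r, clamped_quotient.
    assert (Q0 : 0 <= SF2R (fdiv F o (SFabs a)))
      by (apply (nearest_ge F _ _ _ q2 (representable_0 F)); assumption).
    destruct (fmax_value F _ _ q1 z1) as [V1 V2].
    rewrite Rmax_left in V2 by (simpl; lra).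
    destruct (fmin_value F _ _ V1 w1) as [V3 V4]; rewrite V2 in V4.
    split; [exact V3|]; rewrite V4.
    destruct (Rle_lt_dec Omega (SF2R (fdiv F o (SFabs a)))) as [L|L].
    - rewrite Rmin_right by lra; split; [lra|left; split; [reflexivity|]].
      destruct q2 as [_ q2]; specialize (q2 0 (representable_0 F)).
      rewrite Rminus_0_l, Rabs_Ropp, (Rabs_pos_eq x) in q2 by assumption.
      apply Rabs_le_between in q2; lra.
    - rewrite Rmin_left by lra; split; [lra|right; exact q2]. }
  assert (Inf : fdiv F o (SFabs a) = S754_infinity false ->
    clamped_quotient o a = cap).
  { intros Q; unfold clamped_quotient; rewrite Q.
    destruct cap as [s|s| |s m e]; try (now destruct w1); reflexivity. }
  destruct (Rle_lt_or_eq_dec 0 _ Ho0) as [O0|O0].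
  - destruct (Req_dec (SF2R a) 0) as [A0|A0].
    + destruct (fp_zero_inv F _ a1) as [s Hs]; [rewrite a2, A0; apply Rabs_R0|].
      assert (Q : fdiv F o (SFabs a) = S754_infinity false).
      { assert (s = false) as -> by (destruct a; simpl in Hs; congruence).
        rewrite Hs; destruct o as [so|so| |so m e]; try (now destruct Ho).
        - simpl in O0; lra.
        - rewrite SF2R_finite in O0; destruct so; [|reflexivity].
          assert (0 < IZR (Z.pos m) * b2 e)
            by (apply Rmult_lt_0_compat; [apply IZR_lt; lia|apply b2_gt0]); lra. }
      unfold r; rewrite (Inf Q); split; [exact w1|split; [lra|split; [intros; lra|]]].
      intros _; left; split; [reflexivity|now left].
    + assert (A1 : 0 < Rabs (SF2R a)) by now apply Rabs_pos_lt.
      assert (X0 : 0 < SF2R o / Rabs (SF2R a)) by now apply Rdiv_lt_0_compat.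
      pose proof (fdiv_rounds F o (SFabs a) Ho a1 ltac:(lra)) as R.
      rewrite a2 in R; destruct R as [[R1 R2]|[[R1 R2]|[R1 R2]]].
      * destruct (Fin _ R1 (Rlt_le _ _ X0) R2) as (F1 & F2 & F3).
        split; [exact F1|split; [exact F2|split; [intros; lra|intros _]]].
        destruct F3 as [F3|F3]; [left|right]; tauto.
      * unfold r; rewrite (Inf R2).
        split; [exact w1|split; [lra|split; [intros; lra|intros _]]].
        left; split; [reflexivity|right].
        pose proof (fp_le_nu F _ w1) as B; rewrite Rabs_pos_eq in B; lra.
      * pose proof (nu_large F); lra.
  - symmetry in O0; destruct (Req_dec (SF2R a) 0) as [A0|A0].
    + assert (Q : clamped_quotient o a = fmin fzero cap).
      { unfold clamped_quotient; rewrite fdiv_zero_zero with (F := F); auto.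
        rewrite a2, A0; apply Rabs_R0. }
      destruct (fmin_value F _ _ z1 w1) as [V3 V4].
      rewrite Rmin_left in V4 by (change (SF2R fzero) with 0; lra).
      unfold r; rewrite Q, V4; change (SF2R fzero) with 0.
      split; [exact V3|split; [lra|split; [reflexivity|intros; lra]]].
    + assert (A1 : 0 < Rabs (SF2R a)) by now apply Rabs_pos_lt.
      pose proof (fdiv_rounds F o (SFabs a) Ho a1 ltac:(lra)) as R.
      unfold Rdiv in R; rewrite O0, Rmult_0_l in R; pose proof (nu_large F).
      apply rounds_finite in R; [|rewrite Rabs_R0; lra]; destruct R as [R1 R2].
      destruct (Fin _ R1 (Rle_refl 0) R2) as (F1 & F2 & F3).
      split; [exact F1|split; [exact F2|split; [intros _|intros; lra]]].
      destruct F3 as [F3|F3]; [lra|now apply (nearest_0 F)].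
Qed.

(** Error factor of a fused multiply-add under a square root, followed by one more
    operation. *)
Definition Kroot : R := (1 + u / 2) * (1 + u) * (1 + u).

Lemma near_sqrt_rounded x y :
  1 <= x -> near (1 + u) x y -> near (1 + u / 2) (sqrt x) (sqrt y).
Proof.
  intros Hx H; pose proof (eps_small F).
  apply near_sqrt; [lra|lra|]; apply near_weaken with (1 + u); [nra|exact H].
Qed.

Lemma near_normal x y :
  nearest F x y -> u <= Rabs x -> near (1 + u) x y.
Proof.
  intros H Hx; pose proof (min_normal_small F).
  apply (nearest_normal F); [exact H|lra].
Qed.

Definition half_den (t : spec_float) : spec_float :=
  fadd F (fone F) (fsqrt F (fma F t t (fone F))).

Lemma half_den_value t :
  fp_number F t -> Rabs (SF2R t) <= Omega ->
  fp_number F (half_den t) /\ 0 < SF2R (half_den t) /\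
  near Kroot (1 + sqrt (1 + SF2R t * SF2R t)) (SF2R (half_den t)).
Proof.
  intros Ht HT; destruct cap_value as (w1 & w2 & w3).
  destruct (fone_value F) as [o1 o2].
  pose proof (eps_small F) as U; pose proof (nu_large F) as NL.
  assert (T2 : 0 <= SF2R t * SF2R t <= Omega * Omega).
  { pose proof (Rabs_pos (SF2R t)).
    rewrite <- (Rabs_pos_eq (SF2R t * _)), Rabs_mult by nra; split; nra. }
  unfold half_den.
  pose proof (fma_rounds F t t (fone F) Ht Ht o1) as R; rewrite o2 in R.
  apply rounds_finite in R; [|rewrite Rabs_pos_eq; nra].
  destruct R as [f1 f2]; set (f := fma F t t (fone F)) in *.
  assert (f3 : 1 <= SF2R f)
    by (apply (nearest_ge F _ _ _ f2 (representable_1 F)); lra).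
  pose proof (fp_le_nu F f f1) as f4; rewrite Rabs_pos_eq in f4 by lra.
  assert (f5 : near (1 + u) (1 + SF2R t * SF2R t) (SF2R f)).
  { rewrite (Rplus_comm 1 (SF2R t * _)); apply near_normal; [exact f2|].
    rewrite Rabs_pos_eq; lra. }
  assert (s3 : 1 <= sqrt (SF2R f)) by (rewrite <- sqrt_1; apply sqrt_le_1_alt; lra).
  assert (s4 : sqrt (SF2R f) <= nuR / 30).
  { assert (sqrt (SF2R f) <= sqrt nuR) by (apply sqrt_le_1_alt; lra).
    assert (30 <= sqrt nuR).
    { rewrite <- (sqrt_square 30) by lra; apply sqrt_le_1_alt; lra. }
    pose proof (sqrt_sqrt nuR ltac:(lra)); nra. }
  pose proof (fsqrt_rounds F f f1 ltac:(lra)) as R.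
  apply rounds_finite in R; [|rewrite Rabs_pos_eq; lra].
  destruct R as [s1 s2]; set (s := fsqrt F f) in *.
  assert (s5 : 1 <= SF2R s)
    by (apply (nearest_ge F _ _ _ s2 (representable_1 F)); lra).
  assert (s6 : near (1 + u) (sqrt (SF2R f)) (SF2R s))
    by (apply near_normal; [exact s2|rewrite Rabs_pos_eq; lra]).
  assert (s7 : SF2R s <= nuR / 15) by (destruct s6 as (d & -> & Hd); nra).
  assert (s8 : near ((1 + u / 2) * (1 + u)) (sqrt (1 + SF2R t * SF2R t)) (SF2R s)).
  { apply near_trans with (sqrt (SF2R f)); [lra|lra| |exact s6].
    apply near_sqrt_rounded; [lra|exact f5]. }
  pose proof (fadd_rounds F (fone F) s o1 s1) as R; rewrite o2 in R.
  apply rounds_finite in R; [|rewrite Rabs_pos_eq; lra].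
  destruct R as [d1 d2]; split; [exact d1|split].
  - apply Rlt_le_trans with 1; [lra|].
    apply (nearest_ge F _ _ _ d2 (representable_1 F)); lra.
  - apply near_trans with (1 + SF2R s); [nra|lra| |].
    + apply near_succ; [nra|apply sqrt_pos|exact s8].
    + apply near_normal; [exact d2|rewrite Rabs_pos_eq; lra].
Qed.

(** The excess of one percent over 1 absorbs the rounding errors; the bounds on the
    eigenvalues leave room for it. *)
Lemma half_quotient_value t (d := fdiv F t (half_den t)) :
  fp_number F t -> Rabs (SF2R t) <= Omega ->
  fp_number F d /\ Rabs (SF2R d) <= 101 / 100 /\
  (~ underflows F (SF2R t / SF2R (half_den t)) d ->
   near (Kroot * / (1 - u)) (half_tan (SF2R t)) (SF2R d)).
Proof.
  intros Ht HT; destruct (half_den_value t Ht HT) as (h1 & h2 & h3).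
  pose proof (eps_small F) as U; pose proof (nu_large F) as NL.
  pose proof (min_normal_small F) as N.
  assert (K0 : 1 <= Kroot <= 1 + 3 * u) by (unfold Kroot; nra).
  assert (IK : 1 <= / (1 - u)) by apply (inv_1_minus_eps F).
  set (x := SF2R t) in *; set (D := SF2R (half_den t)) in *.
  destruct (sqrt_1_sqr_ge x) as [S1 S2].
  assert (NQ : near Kroot (half_tan x) (x / D)).
  { unfold half_tan; rewrite <- (Rmult_1_l Kroot).
    apply near_div; [lra|lra|apply near_exact; lra|exact h3]. }
  assert (B : Rabs (x / D) <= 1 + 3 * u).
  { destruct NQ as (d' & -> & Hd); assert (0 < / Kroot) by (apply Rinv_0_lt_compat; lra).
    rewrite Rabs_mult, (Rabs_pos_eq d') by lra.
    assert (Rabs (half_tan x) <= 1).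
    { unfold half_tan, Rdiv; rewrite Rabs_mult, Rabs_inv, (Rabs_pos_eq (1 + _)) by lra.
      apply Rle_div_l; lra. }
    pose proof (Rabs_pos (half_tan x)); nra. }
  pose proof (fdiv_rounds F t (half_den t) Ht h1 ltac:(fold D; lra)) as R.
  fold x D in R; apply rounds_finite in R; [|lra].
  destruct R as [r1 r2]; fold d in r1, r2; split; [exact r1|split].
  - apply Rle_trans with (1 := nearest_bound F _ _ r2).
    pose proof (Rabs_pos (x / D)); nra.
  - intros Hu; destruct (Req_dec x 0) as [X0|X0].
    + unfold Rdiv in r2; rewrite X0, Rmult_0_l in r2.
      rewrite (nearest_0 F _ r2), X0, half_tan_0; apply near_exact; nra.
    + apply near_trans with (x / D); [lra|lra|exact NQ|].
      apply (nearest_normal_result F); [exact r2|].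
      apply Rnot_lt_le; intros Hlt; apply Hu; split; [|exact Hlt].
      fold x D; apply Rmult_integral_contrapositive; split; [exact X0|].
      apply Rinv_neq_0_compat; lra.
Qed.

(** * Secant, cosine and sine *)

Lemma secant_value t (s2 := fma F t t (fone F)) (s := fsqrt F s2) :
  fp_number F t -> Rabs (SF2R t) <= 101 / 100 ->
  (fp_number F s2 /\ 1 <= SF2R s2) /\ fp_number F s /\
  fp_number F (fdiv F (fone F) s) /\ fp_number F (fdiv F t s) /\
  near Kroot (/ sqrt (1 + SF2R t * SF2R t)) (SF2R (fdiv F (fone F) s)).
Proof.
  intros Ht HT; destruct (fone_value F) as [o1 o2].
  pose proof (eps_small F) as U; pose proof (nu_large F) as NL.
  assert (T2 : 0 <= SF2R t * SF2R t <= 2) by (apply Rabs_le_between in HT; nra).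
  pose proof (fma_rounds F t t (fone F) Ht Ht o1) as R; rewrite o2 in R.
  apply rounds_finite in R; [|rewrite Rabs_pos_eq; lra].
  destruct R as [f1 f2]; fold s2 in f1, f2.
  assert (f3 : 1 <= SF2R s2)
    by (apply (nearest_ge F _ _ _ f2 (representable_1 F)); lra).
  assert (f5 : near (1 + u) (1 + SF2R t * SF2R t) (SF2R s2)).
  { rewrite (Rplus_comm 1 (SF2R t * _)); apply near_normal; [exact f2|].
    rewrite Rabs_pos_eq; lra. }
  assert (f4 : SF2R s2 <= 4) by (destruct f5 as (d & -> & Hd); nra).
  assert (s3 : 1 <= sqrt (SF2R s2)) by (rewrite <- sqrt_1; apply sqrt_le_1_alt; lra).
  assert (s4 : sqrt (SF2R s2) <= 2).
  { rewrite <- (sqrt_square 2) by lra; apply sqrt_le_1_alt; lra. }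
  pose proof (fsqrt_rounds F s2 f1 ltac:(lra)) as R.
  apply rounds_finite in R; [|rewrite Rabs_pos_eq; lra].
  destruct R as [s1 sn]; fold s in s1, sn.
  assert (s5 : 1 <= SF2R s <= 2).
  { split; [apply (nearest_ge F _ _ _ sn (representable_1 F)); lra|].
    apply (nearest_le F _ _ _ sn (representable_2 F)); lra. }
  assert (s6 : near (1 + u) (sqrt (SF2R s2)) (SF2R s))
    by (apply near_normal; [exact sn|rewrite Rabs_pos_eq; lra]).
  assert (I : / 2 <= / SF2R s <= 1).
  { split; [apply Rinv_le_contravar; lra|].
    rewrite <- Rinv_1; apply Rinv_le_contravar; lra. }
  split; [split; assumption|split; [exact s1|]].
  pose proof (fdiv_rounds F (fone F) s o1 s1 ltac:(lra)) as R.
  rewrite o2 in R; unfold Rdiv in R; rewrite Rmult_1_l in R.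
  apply rounds_finite in R; [|rewrite Rabs_pos_eq; lra].
  destruct R as [c1 c2]; split; [exact c1|].
  pose proof (fdiv_rounds F t s Ht s1 ltac:(lra)) as R.
  apply rounds_finite in R.
  2:{ unfold Rdiv; rewrite Rabs_mult, (Rabs_pos_eq (/ _)) by lra.
      pose proof (Rabs_pos (SF2R t)); nra. }
  destruct R as [d1 _]; split; [exact d1|].
  unfold Kroot; apply near_trans with (/ SF2R s); [nra|lra| |].
  - apply near_inv; [nra|].
    apply near_trans with (sqrt (SF2R s2)); [lra|lra| |exact s6].
    apply near_sqrt_rounded; [lra|exact f5].
  - apply near_normal; [exact c2|rewrite Rabs_pos_eq; lra].
Qed.

(** * Eigenvalues *)

(** With [B = nu / 5.6], the magnitude of the numerator is at most about
    [1.01 * (1.01 B + 2.04 B) + B < 5 B], and the divisor is at least 1.  Both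
    eigenvalues have this form. *)
Lemma eigenvalue_fp a b o t s :
  fp_number F a -> fp_number F b -> fp_number F o -> fp_number F t ->
  fp_number F s -> 1 <= SF2R s ->
  Rabs (SF2R a) <= nuR / (56 / 10) -> Rabs (SF2R b) <= nuR / (56 / 10) ->
  Rabs (SF2R o) <= 204 / 100 * (nuR / (56 / 10)) ->
  Rabs (SF2R t) <= 101 / 100 ->
  fp_number F (fdiv F (fma F (fma F a t o) t b) s).
Proof.
  intros Ha Hb Ho Ht Hs S1 Ba Bb Bo Bt.
  pose proof (eps_small F) as U; pose proof (nu_large F) as NL.
  pose proof (min_normal_small F) as N.
  set (B := nuR / (56 / 10)) in *.
  assert (NB : nuR = 56 / 10 * B) by (unfold B; field).
  assert (P : forall x c, Rabs x <= c -> Rabs (x * SF2R t) <= 101 / 100 * c).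
  { intros x c Hx; rewrite Rabs_mult, Rmult_comm.
    pose proof (Rabs_pos x); pose proof (Rabs_pos (SF2R t)).
    apply Rmult_le_compat; lra. }
  assert (X1 : Rabs (SF2R a * SF2R t + SF2R o) <= 306 / 100 * B).
  { apply Rle_trans with (1 := Rabs_triang _ _).
    specialize (P _ _ Ba); lra. }
  pose proof (fma_rounds F a t o Ha Ht Ho) as R.
  apply rounds_finite in R; [|lra].
  destruct R as [r1 r2].
  assert (X2 : Rabs (SF2R (fma F a t o)) <= 307 / 100 * B).
  { apply Rle_trans with (1 := nearest_bound F _ _ r2).
    pose proof (Rabs_pos (SF2R a * SF2R t + SF2R o)); nra. }
  assert (X3 : Rabs (SF2R (fma F a t o) * SF2R t + SF2R b) <= 5 * B).
  { apply Rle_trans with (1 := Rabs_triang _ _).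
    specialize (P _ _ X2); lra. }
  pose proof (fma_rounds F _ t b r1 Ht Hb) as R.
  apply rounds_finite in R; [|lra].
  destruct R as [n1 _]; set (n := fma F (fma F a t o) t b) in *.
  pose proof (fp_le_nu F n n1) as n2.
  pose proof (fdiv_rounds F n s n1 Hs ltac:(lra)) as R.
  apply rounds_finite in R; [apply R|].
  assert (0 < / SF2R s <= 1).
  { split; [apply Rinv_0_lt_compat; lra|].
    rewrite <- Rinv_1; apply Rinv_le_contravar; lra. }
  unfold Rdiv; rewrite Rabs_mult, (Rabs_pos_eq (/ _)) by lra.
  pose proof (Rabs_pos (SF2R n)); nra.
Qed.

End Tangents.

(** * The quantities attached to the matrix *)

Section Matrix.
Context (F : format) {WF : wide_format F} (A : hermitian2).
Context (HA : hermitian2_fp F A) (Hmax : abs_max A <= SF2R (nu F) / (4 * sqrt 2)).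
Local Notation u := (eps F).
Local Notation nuR := (SF2R (nu F)).
Local Notation a := (SF2R (a11 A) - SF2R (a22 A)).
Local Notation b := (Cmod (scalar_C (a21 A))).

(** The number 5.6 is a rational lower bound for [4 * sqrt 2]. *)
Lemma entry_bounds :
  Rabs (SF2R (a11 A)) <= nuR / (56 / 10) /\ Rabs (SF2R (a22 A)) <= nuR / (56 / 10) /\
  b <= nuR / (56 / 10).
Proof.
  pose proof (nu_large F) as NL.
  assert (S2 : 14 / 10 <= sqrt 2).
  { rewrite <- (sqrt_square (14 / 10)) by lra; apply sqrt_le_1_alt; lra. }
  assert (H : abs_max A <= nuR / (56 / 10)).
  { apply Rle_trans with (1 := Hmax).
    apply Rmult_le_compat_l; [lra|]; apply Rinv_le_contravar; lra. }
  unfold abs_max in H.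
  pose proof (Rmax_l (Rabs (SF2R (a11 A))) (Rmax b (Rabs (SF2R (a22 A))))).
  pose proof (Rmax_r (Rabs (SF2R (a11 A))) (Rmax b (Rabs (SF2R (a22 A))))).
  pose proof (Rmax_l b (Rabs (SF2R (a22 A)))).
  pose proof (Rmax_r b (Rabs (SF2R (a22 A)))).
  lra.
Qed.

Lemma b_le_nu : b <= nuR / 5.
Proof. destruct entry_bounds as (_ & _ & B); pose proof (nu_large F); lra. Qed.

Lemma fl_o_value :
  fp_number F (fl_o F A) /\ SF2R (fl_o F A) = 2 * SF2R (fl_abs_a21 F A) /\
  0 <= SF2R (fl_o F A) <= 204 / 100 * (nuR / (56 / 10)).
Proof.
  destruct HA as (_ & _ & Hz); destruct entry_bounds as (_ & _ & B).
  pose proof (eps_small F) as U; pose proof (nu_large F) as NL.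
  pose proof (min_normal_small F) as N; pose proof (Cmod_ge_0 (scalar_C (a21 A))).
  destruct (fl_abs_value F _ Hz b_le_nu) as (h1 & h2 & _).
  fold (fl_abs_a21 F A) in h1, h2; set (h := fl_abs_a21 F A) in *.
  assert (h3 : SF2R h <= 102 / 100 * (nuR / (56 / 10))) by nra.
  destruct (fone_value F) as [o1 o2].
  pose proof (fadd_rounds F _ _ o1 o1) as R; rewrite o2 in R.
  apply rounds_finite in R; [|rewrite Rabs_pos_eq; lra]; destruct R as [t1 t2].
  replace (1 + 1) with 2 in t2 by ring.
  apply (nearest_exact F) in t2; [|apply (representable_2 F)].
  unfold fl_o; fold h; set (two := fadd F (fone F) (fone F)) in *.
  pose proof (fmul_rounds F two h t1 h1) as R; rewrite t2 in R.
  apply rounds_finite in R; [|rewrite Rabs_pos_eq; lra]; destruct R as [r1 r2].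
  split; [exact r1|].
  rewrite (nearest_exact F _ _ r2); [split; [reflexivity|lra]|].
  apply (fp_representable F) in h1; destruct h1 as (k & j & -> & Hk & Hj).
  exists k, (j + 1)%Z; split; [rewrite b2_succ; ring|lia].
Qed.

Lemma fl_a_value : fp_number F (fl_a F A) /\ near (1 + u) a (SF2R (fl_a F A)).
Proof.
  destruct HA as (H1 & H2 & _); destruct entry_bounds as (B1 & B2 & _).
  pose proof (nu_large F) as NL.
  pose proof (fsub_rounds F _ _ H1 H2) as R.
  apply rounds_finite in R.
  - destruct R as [r1 r2]; split; [exact r1|].
    apply (nearest_sum F); auto; now apply (fp_representable F).
  - apply Rabs_le_between in B1, B2; apply Rabs_le; lra.
Qed.

Local Notation r := (clamped_quotient F (fl_o F A) (fl_a F A)).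

Lemma fl_tan_2phi_value :
  fp_number F (fl_tan_2phi F A) /\
  Rabs (SF2R (fl_tan_2phi F A)) <= SF2R (fsqrt F (nu F)) /\
  SF2R (fl_tan_2phi F A) = (if signbit (fl_a F A) then -1 else 1) * SF2R r /\
  0 <= SF2R r.
Proof.
  destruct fl_o_value as (o1 & _ & o2), fl_a_value as (a1 & _).
  destruct (clamped_quotient_value F _ _ o1 a1 (proj1 o2)) as (r1 & r2 & _).
  change (fl_tan_2phi F A) with (mul_sign r (fl_a F A)).
  split; [now apply mul_sign_fp|].
  rewrite mul_sign_value.
  destruct (signbit (fl_a F A)); rewrite ?Rabs_Ropp, Rabs_pos_eq by lra;
    (split; [|split]); lra.
Qed.

Lemma fl_tan_phi_value :
  fp_number F (fl_tan_phi F A) /\ Rabs (SF2R (fl_tan_phi F A)) <= 101 / 100.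
Proof.
  destruct fl_tan_2phi_value as (t1 & t2 & _).
  destruct (half_quotient_value F _ t1 t2) as (q1 & q2 & _); now split.
Qed.

Lemma no_overflow_holds : no_overflow F A.
Proof.
  destruct HA as (H1 & H2 & Hz); destruct entry_bounds as (B1 & B2 & _).
  pose proof b_le_nu as Bb.
  destruct (fl_abs_value F _ Hz Bb) as (h1 & _).
  destruct (fl_cos_sin_fp F _ Hz Bb) as (c1 & s1).
  destruct fl_o_value as (o1 & _ & o2), fl_tan_2phi_value as (t1 & _).
  destruct fl_tan_phi_value as (f1 & f2).
  destruct (secant_value F _ f1 f2) as ((x1 & x2) & x3 & x4 & x5 & _).
  assert (o3 : Rabs (SF2R (fl_o F A)) <= 204 / 100 * (nuR / (56 / 10)))
    by (rewrite Rabs_pos_eq; lra).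
  assert (l1 : fp_number F (fl_lambda1 F A)) by (apply eigenvalue_fp; auto).
  assert (l2 : fp_number F (fl_lambda2 F A)).
  { apply eigenvalue_fp; auto using fp_opp; now rewrite SF2R_opp, Rabs_Ropp. }
  repeat split; first [apply h1|apply c1|apply s1|apply t1|apply f1|apply x1
    |apply x3|apply x4|apply x5|apply l1|apply l2].
Qed.

(** * Accuracy of the angle *)

Lemma tan_phi_exact phi :
  is_phi A phi -> 0 < cos phi /\
  (a <> 0 -> tan phi = sign a * half_tan (2 * b / Rabs a)).
Proof.
  intros (Hr & Ha & _); pose proof PI_RGT_0; split.
  - apply cos_gt_0; lra.
  - intros A0; destruct (Ha A0) as [Hc Ht].
    rewrite (tan_half_tan phi Hr Hc), Ht.
    destruct (Rtotal_order a 0) as [L|[L|L]]; [|now elim A0|].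
    + rewrite sign_eq_m1 by assumption.
      replace (2 * b / Rabs a * -1) with (- (2 * b / Rabs a)) by ring.
      rewrite half_tan_opp; ring.
    + rewrite sign_eq_1 by assumption; rewrite Rmult_1_r; ring.
Qed.

Local Notation K := (Kabs F (a21 A)).

Lemma Kabs_bounds : 1 <= K <= 1 + 5 * u.
Proof.
  pose proof (eps_small F) as U; pose proof (Kmod_pos F) as M.
  destruct (a21 A); unfold Kabs; [lra|].
  pose proof (inv_1_minus_eps F); split; [nra|].
  apply Rle_div_l; [lra|]; unfold Kmod; nra.
Qed.

Lemma b_zero_quotient : b = 0 -> SF2R r = 0.
Proof.
  intros B0; destruct HA as (_ & _ & Hz).
  destruct (fl_abs_value F _ Hz b_le_nu) as (_ & _ & h & _).
  destruct fl_o_value as (o1 & o2 & o3), fl_a_value as (a1 & _).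
  destruct (clamped_quotient_value F _ _ o1 a1 (proj1 o3)) as (_ & _ & r2 & _).
  apply r2; rewrite o2; unfold fl_abs_a21; rewrite h by assumption; ring.
Qed.

Lemma tan_phi_b_zero phi : is_phi A phi -> b = 0 -> tan phi = 0.
Proof.
  intros Hphi B0; destruct (tan_phi_exact phi Hphi) as [_ T].
  destruct (Req_dec a 0) as [A0|A0].
  - destruct Hphi as (_ & _ & _ & P); rewrite (P A0 B0); apply tan_0.
  - rewrite (T A0), B0; unfold Rdiv; rewrite Rmult_0_r, Rmult_0_l, half_tan_0; ring.
Qed.

(** Either the quotient is a rounded one, and its factor carries over to the half angle; or it
    is the cap, and both tangents are close to 1 whatever the quotient is. *)
Lemma near_abs_tan_phi phi :
  is_phi A phi -> near K b (SF2R (fl_abs_a21 F A)) ->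
  ~ underflows F (SF2R (fl_o F A) / SF2R (fl_a F A)) (fl_tan_2phi F A) ->
  near (K * (1 + u) * / (1 - u)) (Rabs (tan phi)) (half_tan (SF2R r)).
Proof.
  intros Hphi Hb Hu.
  pose proof (eps_small F) as U; pose proof Kabs_bounds as KB.
  pose proof (inv_1_minus_eps F) as I.
  assert (KU : 1 + u <= K * (1 + u)) by nra.
  assert (KI : 1 + u <= K * (1 + u) * / (1 - u)) by nra.
  pose proof (Cmod_ge_0 (scalar_C (a21 A))) as B0.
  destruct (tan_phi_exact phi Hphi) as [_ T].
  destruct (Rle_lt_or_eq_dec 0 b B0) as [Bp|B0'].
  2:{ symmetry in B0'.
      rewrite (b_zero_quotient B0'), (tan_phi_b_zero phi Hphi B0'), Rabs_R0, half_tan_0.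
      apply near_exact; lra. }
  destruct HA as (_ & _ & Hz).
  destruct (fl_abs_value F _ Hz b_le_nu) as (_ & _ & _ & h).
  specialize (h Bp); fold (fl_abs_a21 F A) in h.
  destruct fl_o_value as (o1 & o2 & o3), fl_a_value as (a1 & a2).
  destruct (clamped_quotient_value F _ _ o1 a1 (proj1 o3)) as (r1 & r2 & _ & r3).
  destruct (cap_value F) as (w1 & w2 & _).
  destruct fl_tan_2phi_value as (_ & _ & t3 & _).
  set (R := SF2R r) in *; set (o := SF2R (fl_o F A)) in *.
  set (ta := SF2R (fl_a F A)) in *; set (W := SF2R (fsqrt F (nu F))) in *.
  assert (W0 : 0 < W).
  { assert (0 < 16 / u) by (apply Rdiv_lt_0_compat; lra); lra. }
  (* [half_tan x] is at least [1 / (1 + 2 / x)], and [2 / x <= 8 / W <= u] *)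
  assert (Big : forall x, W / 4 <= x -> / (1 + u) <= half_tan x <= 1).
  { intros x Hx; destruct (half_tan_bounds x) as [L1 L2]; [lra|].
    split; [|exact L2]; apply Rle_trans with (2 := L1).
    apply Rinv_le_contravar.
    - assert (0 < 2 / x) by (apply Rdiv_lt_0_compat; lra); lra.
    - apply Rplus_le_compat_l; apply Rle_div_l; [lra|].
      assert (16 / u * u = 16) by (field; lra).
      assert (16 <= W * u) by nra; nra. }
  assert (NT : a <> 0 -> Rabs (tan phi) = half_tan (2 * b / Rabs a)).
  { intros A0; rewrite (T A0), Rabs_mult.
    replace (Rabs (sign a)) with 1.
    - assert (0 < 2 * b / Rabs a)
        by (apply Rdiv_lt_0_compat; [lra|now apply Rabs_pos_lt]).
      rewrite Rmult_1_l, Rabs_pos_eq; [reflexivity|].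
      now apply Rlt_le, half_tan_pos.
    - destruct (Rtotal_order a 0) as [L|[L|L]]; [|now elim A0|].
      + rewrite sign_eq_m1 by assumption; rewrite Rabs_left; lra.
      + rewrite sign_eq_1 by assumption; rewrite Rabs_R1; reflexivity. }
  assert (NX : a <> 0 -> near (K * (1 + u)) (2 * b / Rabs a) (o / Rabs ta)).
  { intros A0; apply near_div; [lra|lra| |].
    - rewrite o2; destruct Hb as (d & -> & Hd); exists d; split; [ring|exact Hd].
    - destruct a2 as (d & -> & Hd); exists d; split; [|exact Hd].
      assert (0 < / (1 + u)) by (apply Rinv_0_lt_compat; lra).
      rewrite Rabs_mult, (Rabs_pos_eq d); lra. }
  assert (AA : a <> 0 -> ta <> 0).
  { intros A0; destruct a2 as (d & -> & Hd).
    assert (0 < / (1 + u)) by (apply Rinv_0_lt_compat; lra).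
    apply Rmult_integral_contrapositive; split; [lra|exact A0]. }
  assert (AZ : a = 0 -> ta = 0)
    by (intros A0; destruct a2 as (d & -> & Hd); rewrite A0; ring).
  specialize (r3 ltac:(lra)).
  destruct r3 as [[rW rc]|[A1 rn]].
  - apply near_weaken with (1 + u); [lra|].
    apply near_of_interval; [lra| |rewrite rW; apply Big; lra].
    destruct (Req_dec a 0) as [A0|A0].
    + destruct Hphi as (_ & _ & P & _); rewrite (P A0) by lra.
      rewrite tan_PI4, Rabs_R1; split; [|lra].
      rewrite <- Rinv_1; apply Rinv_le_contravar; lra.
    + rewrite (NT A0); apply Big.
      destruct rc as [rc|rc]; [now elim (AA A0)|].
      destruct (NX A0) as (d & Hd1 & Hd2); rewrite Hd1 in rc.
      assert (0 <= 2 * b / Rabs a).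
      { apply Rlt_le, Rdiv_lt_0_compat; [lra|now apply Rabs_pos_lt]. }
      assert (d <= 2) by nra; nra.
  - assert (A0 : a <> 0) by (intros A0; now apply A1, AZ).
    rewrite (NT A0); apply near_half_tan; [lra| |].
    + apply Rlt_le, Rdiv_lt_0_compat; [lra|now apply Rabs_pos_lt].
    + apply near_trans with (o / Rabs ta); [nra|lra|auto|].
      apply (nearest_normal_result F); [exact rn|].
      apply Rnot_lt_le; intros Hlt; apply Hu; split.
      * fold o ta; apply Rmult_integral_contrapositive; split; [lra|].
        now apply Rinv_neq_0_compat.
      * rewrite t3, Rabs_mult.
        replace (Rabs (if signbit (fl_a F A) then -1 else 1)) with 1; [lra|].
        destruct (signbit _); [rewrite Rabs_left|rewrite Rabs_R1]; lra.
Qed.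

Definition Ktan (z : scalar) : R :=
  Kabs F z * (1 + u) * / (1 - u) * (Kroot F * / (1 - u)).

Local Notation sigma := (if signbit (fl_a F A) then -1 else 1).

(** The computed sign is that of [fl_a], even when this is a zero; hence the exact tangent
    enters with its magnitude, and [sign_tan_phi] compares the signs. *)
Lemma near_fl_tan_phi phi :
  is_phi A phi -> near K b (SF2R (fl_abs_a21 F A)) ->
  ~ underflows F (SF2R (fl_o F A) / SF2R (fl_a F A)) (fl_tan_2phi F A) ->
  ~ underflows F (SF2R (fl_tan_2phi F A) / SF2R (fl_tan_phi_den F A))
      (fl_tan_phi F A) ->
  near (Ktan (a21 A)) (sigma * Rabs (tan phi)) (SF2R (fl_tan_phi F A)).
Proof.
  intros Hphi Hb Hu1 Hu2.
  pose proof (eps_small F) as U; pose proof Kabs_bounds as KB.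
  pose proof (inv_1_minus_eps F) as I.
  destruct fl_tan_2phi_value as (t1 & t2 & t3 & t4).
  destruct (half_quotient_value F _ t1 t2) as (q1 & q2 & q3).
  specialize (q3 Hu2); rewrite t3 in q3.
  assert (1 <= Kroot F) by (unfold Kroot; nra).
  unfold Ktan; apply near_trans with (sigma * half_tan (SF2R r));
    [apply Rmult_lt_0_compat; nra|apply Rmult_lt_0_compat; lra| |].
  - destruct (near_abs_tan_phi phi Hphi Hb Hu1) as (d & -> & Hd).
    exists d; split; [ring|exact Hd].
  - replace (sigma * half_tan (SF2R r)) with (half_tan (sigma * SF2R r)); [exact q3|].
    destruct (signbit _); [|rewrite !Rmult_1_l; reflexivity].
    replace (-1 * SF2R r) with (- SF2R r) by ring.
    rewrite half_tan_opp; ring.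
Qed.

Lemma sign_tan_phi phi :
  is_phi A phi -> zero_a_positive F A -> tan phi = sigma * Rabs (tan phi).
Proof.
  intros Hphi Hz; pose proof (Cmod_ge_0 (scalar_C (a21 A))) as B0.
  destruct (Rle_lt_or_eq_dec 0 b B0) as [Bp|B0'].
  2:{ symmetry in B0'; rewrite (tan_phi_b_zero phi Hphi B0'), Rabs_R0; ring. }
  destruct (Req_dec a 0) as [A0|A0].
  - rewrite Hz; [|exact A0|intros Z; rewrite Z, Cmod_0 in Bp; lra].
    destruct Hphi as (_ & _ & P & _); rewrite (P A0), tan_PI4, Rabs_R1 by lra; ring.
  - destruct fl_a_value as (a1 & d & Ha & Hd); pose proof (eps_small F).
    assert (D : 0 < d).
    { assert (0 < / (1 + u)) by (apply Rinv_0_lt_compat; lra); lra. }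
    assert (A1 : SF2R (fl_a F A) <> 0)
      by (rewrite Ha; apply Rmult_integral_contrapositive; split; [lra|exact A0]).
    pose proof (signbit_value F _ a1 A1) as S.
    pose proof (Rabs_pos_lt _ A1) as S0.
    destruct (tan_phi_exact phi Hphi) as [_ T]; rewrite (T A0).
    assert (G : 0 < half_tan (2 * b / Rabs a)).
    { apply half_tan_pos, Rdiv_lt_0_compat; [lra|now apply Rabs_pos_lt]. }
    destruct (Rtotal_order a 0) as [L|[L|L]]; [|now elim A0|].
    + rewrite sign_eq_m1 by assumption.
      assert (SF2R (fl_a F A) < 0) by (rewrite Ha; nra).
      destruct (signbit _); [|lra].
      rewrite (Rabs_left1 (-1 * _)); lra.
    + rewrite sign_eq_1 by assumption.
      assert (0 < SF2R (fl_a F A)) by (rewrite Ha; nra).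
      destruct (signbit _); [lra|].
      rewrite (Rabs_pos_eq (1 * _)); lra.
Qed.

(** The cosine depends on the square of the tangent only, so that the sign does not matter. *)
Lemma near_fl_cos_phi phi :
  is_phi A phi ->
  near (Ktan (a21 A)) (sigma * Rabs (tan phi)) (SF2R (fl_tan_phi F A)) ->
  near (Ktan (a21 A) * Kroot F) (cos phi) (SF2R (fl_cos_phi F A)).
Proof.
  intros Hphi Ht.
  pose proof (eps_small F) as U; pose proof Kabs_bounds as KB.
  pose proof (inv_1_minus_eps F) as I.
  destruct (tan_phi_exact phi Hphi) as [C _].
  destruct fl_tan_phi_value as (f1 & f2).
  destruct (secant_value F _ f1 f2) as (_ & _ & _ & _ & x).
  assert (1 <= Kroot F) by (unfold Kroot; nra).
  assert (K1 : 1 <= Ktan (a21 A)).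
  { unfold Ktan; assert (1 <= K * (1 + u)) by nra.
    assert (1 <= K * (1 + u) * / (1 - u)) by nra.
    assert (1 <= Kroot F * / (1 - u)) by nra; nra. }
  rewrite (cos_of_tan phi C).
  apply near_trans with (/ sqrt (1 + SF2R (fl_tan_phi F A) * SF2R (fl_tan_phi F A)));
    [lra|unfold Kroot; nra| |exact x].
  apply near_inv, near_sqrt; [lra|lra|nra|].
  apply near_succ; [nra|nra|].
  replace (tan phi * tan phi)
    with (sigma * Rabs (tan phi) * (sigma * Rabs (tan phi))).
  - apply near_mul; auto; lra.
  - transitivity (Rabs (tan phi) * Rabs (tan phi)).
    + destruct (signbit _); ring.
    + rewrite <- Rabs_mult, Rabs_pos_eq; nra.
Qed.

End Matrix.

(** * Numerical bounds on the error factors *)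

(** Error factors are quotients of polynomials in [u]; this reduces the bounds on them to two
    polynomial inequalities. *)
Lemma factor_bounds n P lo hi u d :
  0 < u < 1 -> 0 < P ->
  P * (1 - lo * u) < (1 - u) ^ n -> P < (1 + hi * u) * (1 - u) ^ n ->
  / (P / (1 - u) ^ n) <= d <= P / (1 - u) ^ n ->
  1 - lo * u < d < 1 + hi * u.
Proof.
  intros Hu HP Hlo Hhi Hd.
  assert (V : 0 < (1 - u) ^ n) by (apply pow_lt; lra).
  split.
  - apply Rlt_le_trans with (2 := proj1 Hd).
    replace (/ (P / (1 - u) ^ n)) with ((1 - u) ^ n / P) by (field; lra).
    apply Rlt_div_r; [exact HP|]; lra.
  - apply Rle_lt_trans with (1 := proj2 Hd).
    apply Rlt_div_l; lra.
Qed.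

Lemma power_scale e u : 0 < u <= e -> forall n, 0 < u ^ n /\ u ^ S n <= e * u ^ n.
Proof.
  intros Hu n; assert (0 < u ^ n) by (apply pow_lt; lra).
  split; [assumption|simpl; nra].
Qed.

(** Since [u ^ (n + 1) <= e * u ^ n] for every [n], polynomial inequalities near 0 become
    linear in the monomials; the largest degree that occurs is below 14. *)
Ltac by_first_order U :=
  pose proof (power_scale _ _ U) as W;
  let rec go n := lazymatch n with
    | O => idtac
    | S ?m => pose proof (W n); go m
    end in go 14%nat;
  clear W; simpl pow in *; lra.

Section NumericalBounds.
Context (F : format) {WF : wide_format F}.
Local Notation u := (eps F).

Lemma arg_factor_bounds d :
  / Karg F <= d <= Karg F -> 1 - 4.000000 * u < d < 1 + 4.000001 * u.
Proof.
  pose proof (eps_small F) as U.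
  replace (Karg F) with ((1 + u) * (1 + u) * (1 + u * u) / (1 - u) ^ 2)
    by (unfold Karg, Kmod; field; lra).
  apply factor_bounds; [lra|nra| |]; by_first_order U.
Qed.

Lemma tan_factor_bounds z d :
  / Ktan F z <= d <= Ktan F z ->
  match z with
  | RealScalar _ => 1 - 5.500000 * u < d < 1 + 5.500001 * u
  | ComplexScalar _ _ => 1 - 11.500000 * u < d < 1 + 11.500004 * u
  end.
Proof.
  pose proof (eps_small F) as U; destruct z.
  - replace (Ktan F _) with ((1 + u) * ((1 + u / 2) * (1 + u) * (1 + u)) / (1 - u) ^ 2)
      by (unfold Ktan, Kabs, Kroot; field; lra).
    apply factor_bounds; [lra|nra| |]; by_first_order U.
  - replace (Ktan F _) with
      ((1 + u) * (1 + u) * (1 + u * u) * (1 + u)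
         * ((1 + u / 2) * (1 + u) * (1 + u)) / (1 - u) ^ 3)
      by (unfold Ktan, Kabs, Kmod, Kroot; field; lra).
    apply factor_bounds; [lra|repeat apply Rmult_lt_0_compat; nra| |];
      by_first_order U.
Qed.

Lemma cos_factor_bounds z d :
  / (Ktan F z * Kroot F) <= d <= Ktan F z * Kroot F ->
  match z with
  | RealScalar _ => 1 - 8.000000 * u < d < 1 + 8.000002 * u
  | ComplexScalar _ _ => 1 - 14.000000 * u < d < 1 + 14.000006 * u
  end.
Proof.
  pose proof (eps_small F) as U; destruct z.
  - replace (Ktan F _ * _) with
      ((1 + u) * ((1 + u / 2) * (1 + u) * (1 + u)) * ((1 + u / 2) * (1 + u) * (1 + u))
         / (1 - u) ^ 2)
      by (unfold Ktan, Kabs, Kroot; field; lra).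
    apply factor_bounds; [lra|repeat apply Rmult_lt_0_compat; nra| |];
      by_first_order U.
  - replace (Ktan F _ * _) with
      ((1 + u) * (1 + u) * (1 + u * u) * (1 + u)
         * ((1 + u / 2) * (1 + u) * (1 + u)) * ((1 + u / 2) * (1 + u) * (1 + u))
         / (1 - u) ^ 3)
      by (unfold Ktan, Kabs, Kmod, Kroot; field; lra).
    apply factor_bounds; [lra|repeat apply Rmult_lt_0_compat; nra| |];
      by_first_order U.
Qed.

End NumericalBounds.

Theorem proposition2p4 (F : format) (A : hermitian2) :
  ieee_binary F ->
  (23 <= sig_bits F)%Z ->
  hermitian2_fp F A ->
  abs_max A <= SF2R (nu F) / (4 * sqrt 2) ->
  no_overflow F A /\
  forall alpha phi : R,
    is_arg (scalar_C (a21 A)) alpha ->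
    is_phi A phi ->
    zero_a21_positive A ->
    no_underflow F A ->
    exists d_alpha' d_alpha'' d_phi d_c : R,
      SF2R (fl_cos_alpha F A) = d_alpha' * cos alpha /\
      SF2R (fl_sin_alpha F A) = d_alpha'' * sin alpha /\
      (zero_a_positive F A -> SF2R (fl_tan_phi F A) = d_phi * tan phi) /\
      SF2R (fl_cos_phi F A) = d_c * cos phi /\
      1 - 4.000000 * eps F < d_alpha' < 1 + 4.000001 * eps F /\
      1 - 4.000000 * eps F < d_alpha'' < 1 + 4.000001 * eps F /\
      1 - 4.000000 * eps F < Cmod (fl_exp_i_alpha F A) < 1 + 4.000001 * eps F /\
      1 - 4.000000 * eps F < Cmod (fl_exp_mi_alpha F A) < 1 + 4.000001 * eps F /\
      match a21 A with
      | RealScalar _ =>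
          1 - 5.500000 * eps F < d_phi < 1 + 5.500001 * eps F /\
          1 - 8.000000 * eps F < d_c < 1 + 8.000002 * eps F
      | ComplexScalar _ _ =>
          1 - 11.500000 * eps F < d_phi < 1 + 11.500004 * eps F /\
          1 - 14.000000 * eps F < d_c < 1 + 14.000006 * eps F
      end.
Proof.
  intros HF Hs HA Hmax; pose proof (ieee_wide F HF Hs) as WF.
  split; [now apply no_overflow_holds|].
  intros alpha phi Halpha Hphi Hz (Hu1 & Hu2 & Hu3 & _).
  pose proof (b_le_nu F A Hmax) as Hb; pose proof HA as (_ & _ & H21).
  assert (Hu : no_underflow_polar F (a21 A)).
  { unfold fl_cos_alpha, fl_sin_alpha, fl_abs_a21 in Hu1.
    unfold no_underflow_polar; destruct (a21 A); exact Hu1. }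
  destruct (fl_cos_sin_accurate F _ alpha H21 Hb Halpha Hz Hu) as [Hc Hsn].
  pose proof (fl_abs_accurate F _ H21 Hb Hu) as Habs.
  pose proof (near_fl_tan_phi F A HA Hmax phi Hphi Habs Hu2 Hu3) as Ht.
  pose proof (near_fl_cos_phi F A HA Hmax phi Hphi Ht) as Hcos.
  assert (K0 : 0 < Karg F).
  { pose proof (Kmod_pos F); pose proof (inv_1_minus_eps F).
    unfold Karg; nra. }
  assert (Hsn' : near (Karg F) (sin (- alpha)) (- SF2R (fl_sin_arg F (a21 A))))
    by (rewrite sin_neg; now apply near_opp).
  assert (Hc' : near (Karg F) (cos (- alpha)) (SF2R (fl_cos_arg F (a21 A))))
    by now rewrite cos_neg.
  pose proof (Cmod_near _ _ _ _ K0 Hc Hsn) as M1.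
  pose proof (Cmod_near _ _ _ _ K0 Hc' Hsn') as M2.
  destruct Hc as (d1 & E1 & B1), Hsn as (d2 & E2 & B2).
  destruct Ht as (d3 & E3 & B3), Hcos as (d4 & E4 & B4).
  exists d1, d2, d3, d4.
  split; [exact E1|split; [exact E2|split; [|split; [exact E4|]]]].
  { intros Hpos; rewrite (sign_tan_phi F A HA Hmax phi Hphi Hpos); exact E3. }
  apply (tan_factor_bounds F) in B3; apply (cos_factor_bounds F) in B4.
  repeat (split; [now apply (arg_factor_bounds F)|]).
  destruct (a21 A); now split.
Qed.
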